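(* Let $p,\ell$ be integers with $p>3$ and $2\le \ell\le p$, and let $F$ be a doubly edge-$p$-critical $2$-graph in class $\ell$. Then for all sufficiently large $n$ (i.e. $1/n\ll p$), $$\mathrm{ar}(n,3,F^{(3)})=t_p(n,3)+\ell.$$
   Context: An $r$-graph is identified with its edge set, a family of $r$-element subsets of a vertex set; $K_n^r=\binom{[n]}{r}$. For an edge-coloring of an $r$-graph, a subgraph is rainbow if no two of its edges have the same color. The anti-Ramsey number $\mathrm{ar}(n,r,H)$ is the minimum number $c$ such that every edge-coloring of $K_n^r$ using at least $c$ colors contains a rainbow subgraph isomorphic to $H$. For a $2$-graph $F$, the expansion $F^{(r)}$ is the $r$-graph on $|V(F)|+(r-2)|F|$ vertices obtained by adding to each edge of $F$ a set of $r-2$ new vertices (distinct new vertices for distinct edges). $\chi$ denotes the chromatic number. A $2$-graph $F$ is doubly edge-$p$-critical if $\chi(F-e)\ge p$ for every edge $e\in F$ and there exist two edges $e_1,e_2\in F$ with $\chi(F-e_1-e_2)=p-1$. For a partition $\mathcal P=V_1\cup\dots\cup V_{p-1}$ of $V(F)$ into $p-1$ parts, the index vector is $\mathbf a_F(\mathcal P)=(e(V_1),\dots,e(V_{p-1}))$, where $e(V_i)$ is the number of edges of $F$ inside $V_i$. Let $\mathbf{\mathcal P}(F)$ be the set of $(p-1)$-partitions $\mathcal P$ of $V(F)$ with $\|\mathbf a_F(\mathcal P)\|_\infty=1$. For $1\le \ell\le p-1$, $F$ is in class $\ell$ if $\min_{\mathcal P\in\mathbf{\mathcal P}(F)}\|\mathbf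 a_F(\mathcal P)\|_1=\ell$; if $\mathbf{\mathcal P}(F)=\emptyset$, $F$ is in class $p$. $T_p(n,r)$ is the $r$-graph on $[n]$ obtained by partitioning $[n]$ into $p-1$ parts whose sizes differ by at most one and taking all $r$-sets meeting each part in at most one vertex; $t_p(n,r)=|T_p(n,r)|$. *)

(* Defs.v *)
From mathcomp Require Import all_boot.
From mathcomp Require Import boolp.

Set Implicit Arguments.
Unset Strict Implicit.
Unset Printing Implicit Defensive.

(* A hypergraph on the vertex set V (all of the finite type V) is identified
   with its edge set, of type {set {set V}}. *)
Definition uniform (r : nat) (V : finType) (G : {set {set V}}) : bool :=
  [forall e in G, #|e| == r].

Definition complete_rgraph (n r : nat) : {set {set 'I_n}} :=
  [set e : {set 'I_n} | #|e| == r].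

Section Chromatic.
Variable V : finType.
Implicit Type F : {set {set V}}.

Definition proper_coloring F (k : nat) (f : {ffun V -> 'I_k}) : bool :=
  [forall x, forall y, (x != y) && ([set x; y] \in F) ==> (f x != f y)].

Definition colorable F (k : nat) : bool :=
  [exists f : {ffun V -> 'I_k}, proper_coloring F f].

Lemma colorable_ex F : exists k, colorable F k.
Proof.
exists #|V|; apply/existsP; exists [ffun x => enum_rank x].
apply/'forall_forallP => x y; apply/implyP => /andP[xy _].
by rewrite !ffunE (inj_eq enum_rank_inj).
Qed.

Definition chi F : nat := ex_minn (colorable_ex F).

Definition doubly_edge_critical (p : nat) F : Prop :=
  (forall e, e \in F -> p <= chi (F :\ e)) /\
  (exists e1 e2, [/\ e1 \in F, e2 \in F, e1 != e2
                   & chi (F :\ e1 :\ e2) = p.-1]).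

(* A partition of V into k parts V_i is encoded by the function mapping each
   vertex to the index of its part; parts may be empty. *)
Definition index_vector (k : nat) F (P : {ffun V -> 'I_k}) : {ffun 'I_k -> nat} :=
  [ffun i => #|[set e in F | e \subset [set x | P x == i]]|].

Definition norm_inf (k : nat) (a : {ffun 'I_k -> nat}) : nat := \max_i a i.
Definition norm_one (k : nat) (a : {ffun 'I_k -> nat}) : nat := \sum_i a i.

Definition unit_partitions (p : nat) F : {set {ffun V -> 'I_p.-1}} :=
  [set P : {ffun V -> 'I_p.-1} | norm_inf (index_vector F P) == 1].

Definition in_class (p l : nat) F : Prop :=
  [/\ 1 <= l <= p.-1,
      exists2 P, P \in unit_partitions p F & norm_one (index_vector F P) = l
    & forall P, P \in unit_partitions p F -> l <= norm_one (index_vector F P)]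
  \/ (l = p /\ unit_partitions p F = set0).

End Chromatic.

Section Expansion.
Variables (r : nat) (V : finType) (F : {set {set V}}).

(* The new vertices are the pairs (e, i) with e an edge of F and i < r - 2. *)
Definition expansion_vertex : finType :=
  (V + {e : {set V} | e \in F} * 'I_(r - 2))%type.

Definition expansion_edge (e : {e : {set V} | e \in F}) :
    {set expansion_vertex} :=
  [set (inl x : expansion_vertex) | x in val e] :|:
  [set (inr (e, i) : expansion_vertex) | i : 'I_(r - 2)].

Definition expansion : {set {set expansion_vertex}} :=
  [set expansion_edge e | e : {e : {set V} | e \in F}].

End Expansion.

Section AntiRamsey.

(* Only the values of a coloring c on the edges of the colored graph matter. *)
Definition num_colors (V : finType) (G : {set {set V}}) (c : {set V} -> nat) :
    nat :=
  size (undup [seq c e | e in G]).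

Definition rainbow (V : finType) (c : {set V} -> nat) (S : {set {set V}}) :
    Prop :=
  {in S &, injective c}.

Definition has_rainbow (V W : finType) (G : {set {set V}})
    (c : {set V} -> nat) (H : {set {set W}}) : Prop :=
  exists g : W -> V,
    let S := [set g @: (e : {set W}) | e in H] in
    [/\ injective g, S \subset G & rainbow c S].

Variables (n r : nat) (W : finType) (H : {set {set W}}).

Definition forces_rainbow (m : nat) : Prop :=
  forall c : {set 'I_n} -> nat,
    m <= num_colors (complete_rgraph n r) c ->
    has_rainbow (complete_rgraph n r) c H.

Lemma forces_rainbow_ex : exists m, `[< forces_rainbow m >].
Proof.
exists #|complete_rgraph n r|.+1; apply/asboolP => c.
rewrite ltnNge; case/negP.
by apply: leq_trans (size_undup _) _; rewrite size_image.
Qed.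

Definition ar : nat := ex_minn forces_rainbow_ex.

End AntiRamsey.

(* The balanced partition of [n] into k parts is taken to be the one into
   residue classes mod k; any other balanced one gives an isomorphic graph. *)
Definition residue_part (n k i : nat) : {set 'I_n} :=
  [set x : 'I_n | x %% k == i].

Lemma card_residue_part (n k i : nat) :
  i < k -> #|residue_part n k i| = n %/ k + (i < n %% k).
Proof.
move=> ik; have k0 : 0 < k by apply: leq_trans ik.
have -> : #|residue_part n k i| = \sum_(x < n) (x %% k == i).
  by rewrite -sum1dep_card big_mkcond; apply: eq_bigr => x _; case: eqP.
elim: n => [|n IHn]; first by rewrite big_ord0 div0n mod0n.
rewrite big_ord_recr /= IHn divnS // modnS.
have mk : n %% k < k by rewrite ltn_mod.
case: ifPn => [dv|ndv]; last first.
  rewrite add0n -addnA; congr (_ + _).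
  by rewrite ltnS eq_sym; case: ltngtP.
have e : n %% k = k.-1.
  move: dv; rewrite /dvdn -addn1 -modnDml addn1.
  case: (ltnP (n %% k).+1 k) => [lt|ge]; first by rewrite modn_small.
  by move=> _; apply/eqP; rewrite -eqSS prednK // eqn_leq mk.
rewrite e addn0 -addnA [RHS]addnC; congr (_ + _).
by move: ik; rewrite -{1}(prednK k0) ltnS eq_sym; case: ltngtP.
Qed.

Lemma residue_part_balanced (n k i j : nat) :
  i < k -> j < k -> #|residue_part n k i| <= #|residue_part n k j|.+1.
Proof.
move=> ik jk; rewrite !card_residue_part // -addnS leq_add2l.
by apply: leq_trans (leq_b1 _) _.
Qed.

Definition turan (p n r : nat) : {set {set 'I_n}} :=
  [set e in complete_rgraph n r |
    [forall i : 'I_p.-1, #|e :&: residue_part n p.-1 i| <= 1]].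

Definition turan_number (p n r : nat) : nat := #|turan p n r|.

(* Main.v *)
Require Import Defs.
From mathcomp Require Import all_boot perm boolp zify ring.

Set Implicit Arguments.
Unset Strict Implicit.
Unset Printing Implicit Defensive.

(* Write [k = p - 1].  Lower bound: give distinct colors to the Turan triples and color
   a triple with at least two vertices in part [i] by [min i (l - 2)]; a rainbow copy of
   the expansion would yield a [k]-partition of [F] with at most one edge in each part
   and fewer than [l] such edges in total.

   Upper bound: deleting vertices that lie in few private colors, one may assume that
   every vertex lies in at least as many private colors as a vertex of the Turan graph.
   Keep one triple of each color and let [H] be the graph of the pairs of large codegree.
   A copy of [F] in [H], except for a few edges that are extended by triples of other
   distinct colors, is completed greedily to a rainbow expansion, so no vertex of [H] is
   joined to a complete [k]-partite graph with large parts: one critical edge is taken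
   at that vertex, and the second one uses a triple of whatever color.  All but boundedly
   many vertices have a link that is almost contained in [H], so the Erdos-Stone theorem,
   applied in their [H]-neighborhoods, bounds their [H]-degrees from below by almost
   [(1 - 1/k) n].  It follows that [H] almost contains a complete balanced [k]-partite
   graph, with every vertex joined to almost all of the other parts.  By double
   criticality, all triples with two vertices in a given part then have the same color,
   hence each part contributes at most one color outside of the crossing triples.  Having
   [l] extra colors means either [l <= k] and the partition defining the class of [F]
   embeds, or [l > k], which is absurd. *)

(** * Graphs of positive density *)

Section Graphs.
Variable T : finType.
Implicit Types (H : rel T) (S : {set T}).

Definition nbr H (x : T) : {set T} := [set y | H x y].

(** A complete [k]-partite subgraph of [H] with parts of size [t]; the parts are disjoint as soon as
    [H] is irreflexive. *)
Definition blowup H (k t : nat) (A : 'I_k -> {set T}) : Prop :=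
  (forall i, #|A i| = t) /\
  (forall i j x y, i != j -> x \in A i -> y \in A j -> H x y).

Lemma exists_subset_card (A : {set T}) t : t <= #|A| ->
  exists2 B : {set T}, B \subset A & #|B| = t.
Proof.
elim: t => [|t IHt] tA; first by exists set0; rewrite ?sub0set ?cards0.
have [B BA Bt] := IHt (ltnW tA).
have /properP[_ [x xA xB]] : B \proper A by rewrite properEcard BA Bt.
exists (x |: B); last by rewrite cardsU1 xB Bt.
by rewrite subUset sub1set xA.
Qed.

Lemma pigeonhole_fiber (S : {set T}) (U : finType) (Y : {set U}) (f : T -> U) t :
  (forall x, x \in S -> f x \in Y) -> #|Y| * t < #|S| ->
  exists y, t < #|[set x in S | f x == y]|.
Proof.
move=> fY lt; apply/existsP; rewrite -[X in is_true X]negbK.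
apply/negP => /existsPn no.
move: lt; rewrite ltnNge -sum1_card (partition_big f (mem Y)) //=.
rewrite -sum_nat_const; case/negP; apply: leq_sum => y _.
by rewrite sum1dep_card leqNgt no.
Qed.

Lemma sum_card_nbr H (A B : {set T}) : symmetric H ->
  \sum_(x in A) #|nbr H x :&: B| = \sum_(y in B) #|nbr H y :&: A|.
Proof.
move=> symH.
have E (C D : {set T}) : \sum_(x in C) #|nbr H x :&: D| =
    \sum_(x in C) \sum_(y in D) H x y.
  apply: eq_bigr => x _; rewrite -sum1_card big_mkcond [RHS]big_mkcond /=.
  by apply: eq_bigr => y _; rewrite !inE; case: (y \in D); case: (H x y).
rewrite !E exchange_big /=.
by apply: eq_bigr => y _; apply: eq_bigr => x _; rewrite symH.
Qed.

End Graphs.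

(** For [r > 0], the degrees inside [S] are at least [(1 - 1/r + 1/M) #|S|]. Induction on [r]: given
    a blowup with one part fewer and larger parts, double counting finds many vertices of [S] with
    [t] neighbors in each part, and [t] of these with the same trace on the blowup form the new
    part. *)
Lemma min_degree_blowup r t M : 0 < M -> exists n0, forall (T : finType) (H : rel T)
    (S : {set T}), symmetric H -> irreflexive H -> n0 <= #|S| ->
  (forall x, x \in S -> (r.-1 * M + r) * #|S| <= r * M * #|nbr H x :&: S|) ->
  exists2 A : 'I_r.+1 -> {set T}, (forall i, A i \subset S) & blowup H t A.
Proof.
move=> M0; elim: r t => [|r IHr] t.
  exists t => T H S symH irrH tS _.
  have [B BS Bt] := exists_subset_card tS.
  by exists (fun _ => B) => //; split=> // i j x y; rewrite !ord1.
case: t => [|t0].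
  exists 0 => T H S _ _ _ _; exists (fun _ => set0) => [i|]; first exact: sub0set.
  by split=> [i|i j x y _]; rewrite ?cards0 // inE.
(* On average a vertex of [S] has at least [r s + 2 (r + 1) t] neighbors in the blowup, one that is
   poor in some part at most [r s + t]; the factor 2 keeps a gap of at least [t]. *)
set t := t0.+1; pose s := 2 * M * t.
have [n0 n0P] := IHr s.
exists (n0 + 2 * M * r.+1 * (2 ^ (r.+1 * s) * t).+1) => T H S symH irrH nS degS.
have [|||x xS|A AS [Acard Aadj]] := n0P T H S => //; first by lia.
  have := degS x xS; rewrite /= => dx.
  have d2 : r * (r * M + r.+1) * #|S| <= r * (r.+1 * M * #|nbr H x :&: S|).
    by rewrite -mulnA leq_mul2l dx orbT.
  case: r {IHr n0P degS nS} dx d2 => [|r] /= dx d2; first by [].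
  rewrite -(leq_pmul2l (ltn0Sn r.+1)); nia.
have sumA x : x \notin [set x in S | [forall i, t <= #|nbr H x :&: A i|]] ->
    x \in S -> \sum_i #|nbr H x :&: A i| <= r * s + t.
  rewrite inE => + xS; rewrite xS => /forallPn /= [i]; rewrite -ltnNge => lti.
  rewrite (bigD1 i) //= addnC leq_add //; last exact: ltnW.
  apply: leq_trans (_ : \sum_(j | j != i) s <= _).
    apply: leq_sum => j _; rewrite -(Acard j); exact: subset_leq_card (subsetIr _ _).
  rewrite sum_nat_const leq_mul2r; apply/orP; right.
  by rewrite cardC1 card_ord.
set Rich := [set x in S | _] in sumA.
have RS : Rich \subset S by apply/subsetP => x; rewrite inE => /andP[].
have bigsum : \sum_(x in S) \sum_i #|nbr H x :&: A i| <=
    #|S| * (r * s + t) + #|Rich| * (r.+1 * s).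
  rewrite (big_setID Rich) /= (setIidPr RS) addnC leq_add //.
    apply: leq_trans (_ : \sum_(x in S :\: Rich) (r * s + t) <= _).
      by apply: leq_sum => x /setDP[xS xR]; apply: sumA.
    by rewrite sum_nat_const leq_mul2r subset_leq_card ?orbT // subsetDl.
  rewrite -sum_nat_const; apply: leq_sum => x _.
  apply: leq_trans (_ : \sum_(i < r.+1) s <= _); last by rewrite sum_nat_const card_ord.
  by apply: leq_sum => i _; rewrite -(Acard i) subset_leq_card ?subsetIr.
have degsum : #|S| * (r * s + r.+1 * (2 * t)) <= \sum_(x in S) \sum_i #|nbr H x :&: A i|.
  rewrite exchange_big /= -(leq_pmul2l (_ : 0 < r.+1 * M)); last by lia.
  apply: leq_trans (_ : \sum_(i < r.+1) \sum_(x in A i) (r * M + r.+1) * #|S| <= _).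
    rewrite (eq_bigr (fun _ => s * ((r * M + r.+1) * #|S|))) => [|i _].
      rewrite sum_nat_const card_ord /s.
      have -> : r.+1 * M * (#|S| * (r * (2 * M * t) + r.+1 * (2 * t))) =
        r.+1 * (2 * M * t * ((r * M + r.+1) * #|S|)) by lia.
      exact: leqnn.
    by rewrite sum_nat_const Acard.
  rewrite big_distrr /=; apply: leq_sum => i _.
  rewrite sum_card_nbr // big_distrr /=; apply: leq_sum => x xA.
  by apply: degS; apply: subsetP (AS i) _ xA.
have Rbig : #|S| <= #|Rich| * (2 * M * r.+1).
  have := leq_trans degsum bigsum; rewrite {3}/s.
  rewrite mulnDr mulnDr -addnA leq_add2l => le.
  have {}le : #|S| * t <= #|Rich| * (r.+1 * (2 * M * t)).
    rewrite -(leq_add2l (#|S| * t)); apply: leq_trans le.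
    rewrite -mulnDr leq_mul2l; apply/orP; right; nia.
  rewrite -(leq_pmul2r (ltn0Sn t0)); lia.
pose U := \bigcup_i A i.
have cU : #|U| <= r.+1 * s.
  apply: leq_trans (_ : \sum_i #|A i| <= _).
    rewrite /U; elim/big_rec2 : _ => [|i m B _ le]; first by rewrite cards0.
    by apply: leq_trans (leq_card_setU _ _) _; rewrite leq_add2l.
  by rewrite (eq_bigr (fun=> s)) ?sum_nat_const ?card_ord.
(* The number of traces on [U] is bounded, so more than [t] rich vertices share one. *)
have [x xR||Y cY] := @pigeonhole_fiber T Rich _ (powerset U) (fun x => nbr H x :&: U) t.
- by rewrite powersetE subsetIr.
- rewrite card_powerset ltnNge; apply/negP => le.
  have le2 : #|Rich| <= 2 ^ (r.+1 * s) * t.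
    by apply: leq_trans le _; rewrite leq_mul2r leq_pexp2l ?orbT.
  have le3 : #|S| <= 2 ^ (r.+1 * s) * t * (2 * M * r.+1).
    by apply: leq_trans Rbig _; rewrite leq_mul2r le2 orbT.
  move: nS; rewrite leqNgt; case/negP; apply: leq_ltn_trans le3 _.
  set q := 2 ^ _ * t; nia.
have [C CY Ct] := exists_subset_card (ltnW cY).
have CYP x : x \in C -> x \in Rich /\ nbr H x :&: U = Y.
  by move/(subsetP CY); rewrite inE => /andP[? /eqP].
have AY i : t <= #|Y :&: A i|.
  have [x xC] : exists x, x \in C by apply/set0Pn; rewrite -cards_eq0 Ct.
  have [xR <-] := CYP x xC; move: xR; rewrite inE => /andP[_ /forallP /(_ i)].
  rewrite -setIA (setIidPr (_ : A i \subset U)) //; exact: bigcup_sup.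
have /fin_all_exists2 [B BY Bt] i := exists_subset_card (AY i).
have BA i x : x \in B i -> x \in A i by move/(subsetP (BY i)); case/setIP.
have BC i x y : x \in B i -> y \in C -> H x y.
  move/(subsetP (BY i)) => /setIP[xY _] /CYP[_ yY].
  by rewrite symH; move: xY; rewrite -yY !inE => /andP[].
exists (fun j => if unlift ord_max j is Some i then B i else C) => [j|].
  case: unliftP => [i _|_]; apply/subsetP => x.
    by move/BA; apply: subsetP (AS i) _.
  by case/CYP; rewrite inE => /andP[].
split=> [j|i j x y]; first by case: unliftP.
case: unliftP => [i' ->|->]; case: unliftP => [j' ->|->] ij.
- by move=> /BA xi /BA yj; apply: Aadj xi yj; rewrite (inj_eq lift_inj) in ij.
- exact: BC.
- by move=> xC yB; rewrite symH; apply: BC yB xC.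
- by rewrite eqxx in ij.
Qed.

(** Passes from average to minimum degree. In a subset [X] maximizing [w] no vertex has low degree,
    since deleting it would increase [w]; comparison with [S] itself shows that [X] is large. Half
    of the gain [1/M] is given up. *)
Lemma erdos_stone r t M : 0 < r -> 0 < M -> exists n0, forall (T : finType) (H : rel T)
    (S : {set T}), symmetric H -> irreflexive H -> n0 <= #|S| ->
  (r.-1 * M + r) * #|S| ^ 2 <= r * M * \sum_(x in S) #|nbr H x :&: S| ->
  exists2 A : 'I_r.+1 -> {set T}, (forall i, A i \subset S) & blowup H t A.
Proof.
case: r => // r _ M0; have [|n0 n0P] := @min_degree_blowup r.+1 t (2 * M); first by lia.
(* The assumed density is [(a + 1) / b]; the unit taken off is what bounds [#|X|] from below. *)
pose a := 4 * r * M + 4 * r.+1 - 1; pose b := 4 * r.+1 * M.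
exists (b * (n0 + a)) => T H S symH irrH nS dens.
pose e (S : {set T}) := \sum_(x in S) #|nbr H x :&: S|.
pose w (X : {set T}) := b * e X + a * (#|S| ^ 2 - #|X| ^ 2).
case: (@arg_maxnP _ S (fun X => X \subset S) w (subxx S)) => X XS Xmax.
have eX2 : e X <= #|X| ^ 2.
  rewrite -mulnn -sum_nat_const; apply: leq_sum => x _.
  exact: subset_leq_card (subsetIr _ _).
have cX := subset_leq_card XS.
have ab : 4 * (r * M + r.+1) = a + 1 by rewrite /a; lia.
have Xbig : #|S| <= b * #|X|.
  have := Xmax S (subxx S); rewrite /w /= subnn muln0 addn0 => le.
  have le2 : (a + 1) * #|S| ^ 2 <= b * e S.
    rewrite -ab /b -(mulnA 4 (_ + _)) -(mulnA 4 r.+1) -(mulnA 4) leq_mul2l /=; exact: dens.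
  have le3 : #|X| ^ 2 <= #|S| ^ 2 by rewrite leq_sqr.
  have le4 : b * e X <= b * #|X| ^ 2 by rewrite leq_mul2l eX2 orbT.
  have le5 : #|S| ^ 2 <= b * #|X| ^ 2.
    have le6 : a * #|X| ^ 2 <= a * #|S| ^ 2 by rewrite leq_mul2l le3 orbT.
    move: le le2 le4 le6; rewrite mulnBr mulnDl mul1n; clear; lia.
  rewrite -leq_sqr; apply: leq_trans le5 _; rewrite expnMn leq_mul2r.
  by rewrite -mulnn leq_pmulr ?orbT // /b; lia.
have [|x xX|A AX Ab] := n0P T H X symH irrH.
- have b0 : 0 < b by rewrite /b; lia.
  have := leq_trans nS Xbig; rewrite leq_pmul2l //; lia.
- have eD : e X = e (X :\ x) + 2 * #|nbr H x :&: X|.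
    rewrite /e (big_setD1 x) //= addnC.
    have -> : \sum_(y in X :\ x) #|nbr H y :&: X| =
        \sum_(y in X :\ x) (#|nbr H y :&: (X :\ x)| + H y x).
      apply: eq_bigr => y _; rewrite -{1}(setD1K xX) setIUr.
      rewrite cardsU (_ : _ :&: _ :&: _ = set0); last first.
        by apply/setP => z; rewrite !inE; case: (z == x); rewrite /= ?andbF.
      rewrite cards0 subn0 addnC; congr (_ + _).
      case Hyx: (H y x).
        rewrite (_ : _ :&: _ = [set x]) ?cards1 //; apply/setP => z.
        by rewrite !inE; case: eqP => [->|]; rewrite ?andbF ?Hyx.
      rewrite (_ : _ :&: _ = set0) ?cards0 //; apply/setP => z.
      by rewrite !inE; case: eqP => [->|]; rewrite ?andbF ?Hyx.
    rewrite big_split /= -addnA; congr (_ + _); rewrite mul2n -addnn; congr (_ + _).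
    rewrite -sum1_card big_mkcond [RHS]big_mkcond /=; apply: eq_bigr => y _.
    rewrite !inE symH; case: eqP => [->|] /=; first by rewrite irrH.
    by case: (y \in X); case: (H x y).
  have cX1 : #|X| = #|X :\ x|.+1 by rewrite (cardsD1 x) xX.
  have := Xmax (X :\ x) (subset_trans (subD1set _ _) XS); rewrite /w eD => le.
  have le3 : #|X| ^ 2 <= #|S| ^ 2 by rewrite leq_sqr.
  have b0 : 0 < b by rewrite /b; lia.
  have aX : a <= #|X| by have := leq_trans nS Xbig; rewrite leq_pmul2l //; lia.
  have cY : #|X :\ x| ^ 2 <= #|X| ^ 2 by rewrite leq_sqr cX1 leqnSn.
  move: (#|nbr H x :&: X|) le => d le.
  rewrite -!mulnn in le le3 cY.
  move: (#|X :\ x|) (#|X|) (#|S|) (e (X :\ x)) cX1 le le3 cY aX => y u s E -> le le3 cY.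
  have {}le : a * (y.+1 * y.+1) <= a * (y * y) + 2 * b * d.
    have le4 : a * (y * y) <= a * (y.+1 * y.+1) by rewrite leq_mul2l cY orbT.
    have le5 : a * (y.+1 * y.+1) <= a * (s * s) by rewrite leq_mul2l le3 orbT.
    rewrite !mulnBr mulnDr in le; move: le le4 le5; clear; lia.
  by rewrite /= /a /b in le *; clear -le; lia.
by exists A => // i; apply: subset_trans (AX i) XS.
Qed.

(** * Embedding expansions *)

Lemma card_bigcup_le (I T : finType) (P : pred I) (A : I -> {set T}) :
  #|\bigcup_(i | P i) A i| <= \sum_(i | P i) #|A i|.
Proof.
elim/big_rec2 : _ => [|i m B _ le]; first by rewrite cards0.
by apply: leq_trans (leq_card_setU _ _) _; rewrite leq_add2l.
Qed.

(** The vertices outside [D] are placed one at a time: a candidate in [R v] fails only if it lies in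
    [Z], is already used, or is one of at most [m] non-neighbors of a placed neighbor of [v]. *)
Lemma greedy_extension (V T : finType) (e : rel V) (H : rel T)
    (R : V -> {set T}) (Z : {set T}) m (D : {set V}) (g0 : V -> T) :
  symmetric e -> irreflexive e -> symmetric H -> {in D &, injective g0} ->
  (forall v w, v \notin D -> w \in D -> e v w -> #|R v :\: nbr H (g0 w)| <= m) ->
  (forall v w, v \notin D -> w \notin D -> e v w ->
    forall x, x \in R w -> #|R v :\: nbr H x| <= m) ->
  (forall v, v \notin D -> #|V| * m + #|V| + #|Z| < #|R v|) ->
  exists g : V -> T, [/\ injective g, {in D, g =1 g0},
    forall v, v \notin D -> g v \in R v :\: Z &
    forall v w, v \notin D -> e v w -> H (g v) (g w)].
Proof.
move=> symE irrE symH; move En: #|~: D| => n.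
elim: n D g0 En => [|n IHn] D g0 En injg HD HR cR.
  have DT v : v \in D by apply/negPn; rewrite -in_setC (cards0_eq En) inE.
  exists g0; split=> [v w||v|v w]; rewrite ?DT //; exact: injg.
have [v] : exists v, v \in ~: D by apply/set0Pn; rewrite -cards_eq0 En.
rewrite inE => vD.
have [x xR] : exists x, x \in R v :\: (Z :|: g0 @: D :|:
    \bigcup_(w | (w \in D) && e v w) (R v :\: nbr H (g0 w))).
  apply/set0Pn; rewrite -card_gt0; set B := _ :|: _.
  have cB : #|B| <= #|Z| + #|V| + #|V| * m.
    apply: leq_trans (leq_card_setU _ _) _; rewrite leq_add //.
      apply: leq_trans (leq_card_setU _ _) _; rewrite leq_add2l.
      by apply: leq_trans (leq_imset_card _ _) _; apply: max_card.
    apply: leq_trans (card_bigcup_le _ _) _.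
    apply: leq_trans (_ : \sum_(w | (w \in D) && e v w) m <= _).
      by apply: leq_sum => w /andP[wD ew]; apply: HD.
    by rewrite sum_nat_const leq_mul2r max_card orbT.
  have := cR v vD; have := subset_leq_card (subsetIr (R v) B).
  rewrite cardsD; lia.
move: xR; rewrite !inE => /andP[/norP[/norP[xZ xg] xU] xR].
have Hx w : w \in D -> e v w -> H x (g0 w).
  move=> wD ew; rewrite symH; apply: contraR xU => nH.
  by apply/bigcupP; exists w; rewrite ?wD // !inE nH.
pose g1 u := if u == v then x else g0 u.
have g1v : g1 v = x by rewrite /g1 eqxx.
have g1D u : u \in D -> g1 u = g0 u.
  by rewrite /g1; case: eqP => // ->; rewrite (negPf vD).
have [||a b|a b|a|g [gi gD gR gH]] := IHn (v |: D) g1.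
- by have := cardsC D; have := cardsC (v |: D); rewrite cardsU1 vD; lia.
- have xD w : w \in D -> x != g0 w.
    by move=> wD; apply: contraNneq xg => ->; apply: imset_f.
  move=> a b /setU1P[->|aD] /setU1P[->|bD] //; rewrite ?g1v ?(g1D a) ?(g1D b) //.
  + by move=> E; have := xD b bD; rewrite E eqxx.
  + by move=> E; have := xD a aD; rewrite E eqxx.
  exact: injg.
- rewrite !inE => /norP[av aD] /orP[/eqP->|bD] eab.
    by rewrite g1v; apply: HR eab _ xR.
  by rewrite g1D //; apply: HD.
- by rewrite !inE => /norP[av aD] /norP[bv bD]; apply: HR.
- by rewrite !inE => /norP[av aD]; apply: cR.
have gv : g v = x by rewrite gD ?setU11.
exists g; split=> // [u uD|u uD|u w uD euw].
- by rewrite gD ?g1D // setU1r.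
- by have [->|uv] := eqVneq u v; [rewrite gv !inE xZ|apply: gR; rewrite !inE negb_or uv].
have [uv|uv] := eqVneq u v; last by apply: gH => //; rewrite !inE negb_or uv.
rewrite uv gv in euw *; have [wD|wD] := boolP (w \in D).
  by rewrite gD ?setU1r // g1D // Hx.
rewrite -gv symH; apply: gH; last by rewrite symE.
rewrite !inE negb_or wD andbT; apply: contraTneq euw => ->; by rewrite irrE.
Qed.

(** Stated over any finite type because colorings are later restricted to subsets of the vertex
    set. *)
Definition triples (T : finType) : {set {set T}} := [set e : {set T} | #|e| == 3].

Section Embedding.
Variables (V T : finType) (F : {set {set V}}) (c : {set T} -> nat).
Hypothesis F2 : uniform 2 F.

Lemma has_rainbow_expansion (g : V -> T) (h : {set V} -> T) :
  injective g -> {in F, forall e, h e \notin g @: setT} -> {in F &, injective h} ->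
  {in F &, injective (fun e => c (h e |: g @: e))} ->
  has_rainbow (triples T) c (expansion 3 F).
Proof.
move=> injg hg injh injc.
pose gg (u : expansion_vertex 3 F) : T :=
  match u with inl v => g v | inr (e, _) => h (val e) end.
have ggE (e : {e | e \in F}) : gg @: expansion_edge 3 e = h (val e) |: g @: val e.
  apply/setP => z; apply/imsetP/setU1P => [[u]|].
    case/setUP => /imsetP[v ve ->] ->; last by left.
    by right; apply: imset_f.
  case=> [->|/imsetP[v ve ->]].
    exists (inr (e, ord0)) => //; apply/setUP; right; exact: imset_f.
  by exists (inl v) => //; apply/setUP; left; apply: imset_f.
exists gg; split.
- case=> [v|[e i]] [w|[e' i']] //= E.
  + by rewrite (injg _ _ E).
  + by have := hg _ (valP e'); rewrite -E imset_f.
  + by have := hg _ (valP e); rewrite E imset_f.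
  have /val_inj -> := injh _ _ (valP e) (valP e') E.
  by rewrite (ord1 i) (ord1 i').
- apply/subsetP => _ /imsetP[_ /imsetP[e _ ->] ->]; rewrite ggE inE.
  have eF := valP e; rewrite cardsU1 card_imset //.
  have /eqP -> := forall_inP F2 _ eF.
  by rewrite (contraNN _ (hg _ eF)) // => /imsetP[v _ ->]; apply: imset_f.
move=> _ _ /imsetP[_ /imsetP[e _ ->] ->] /imsetP[_ /imsetP[e' _ ->] ->].
by rewrite !ggE => /(injc _ _ (valP e) (valP e')) ->.
Qed.

(** [B] holds the edges whose new vertices (apexes) are already chosen, possibly on triples outside
    [G]. For a further edge the forbidden apexes are the [#|V|] vertices of the copy, at most [#|F|]
    used apexes and, [c] being injective on [G], at most one per used color. *)
Lemma rainbow_completion (G : {set {set T}}) (B : {set {set V}}) (g : V -> T)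
    (h : {set V} -> T) :
  G \subset triples T -> {in G &, injective c} -> injective g -> B \subset F ->
  {in B, forall e, h e \notin g @: setT} -> {in B &, injective h} ->
  {in B &, injective (fun e => c (h e |: g @: e))} ->
  (forall e, e \in F -> e \notin B ->
    #|V| + 2 * #|F| < #|[set z | z |: g @: e \in G]|) ->
  has_rainbow (triples T) c (expansion 3 F).
Proof.
move=> G3 cG injg; move En: #|F :\: B| => n.
elim: n B h En => [|n IHn] B h En BF hg injh injc heavy.
  have EB : B = F.
    by apply/eqP; rewrite eqEsubset BF -setD_eq0 -cards_eq0 En.
  by move: hg injh injc; rewrite EB; apply: has_rainbow_expansion.
have [e] : exists e, e \in F :\: B by apply/set0Pn; rewrite -cards_eq0 En.
case/setDP => eF eB.
have He := heavy e eF eB.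
pose col b := c (h b |: g @: b).
pose bad b := [set z | (z |: g @: e \in G) && (c (z |: g @: e) == col b)].
have zge z : z |: g @: e \in G -> z \notin g @: e.
  move/(subsetP G3); rewrite inE cardsU1 card_imset //.
  by have /eqP -> := forall_inP F2 _ eF; case: (z \notin _).
have cbad b : #|bad b| <= 1.
  apply/card_le1_eqP => z z'; rewrite !inE => /andP[zG /eqP zc] /andP[zG' /eqP zc'].
  have E : z |: g @: e = z' |: g @: e by apply: cG; rewrite // zc zc'.
  have : z \in z' |: g @: e by rewrite -E setU11.
  by rewrite !inE (negPf (zge _ zG)) orbF => /eqP.
have cBF : #|B| <= #|F| := subset_leq_card BF.
have [z] : exists z, z \in [set z | z |: g @: e \in G] :\:
    (g @: setT :|: h @: B :|: \bigcup_(b in B) bad b).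
  apply/set0Pn; rewrite -card_gt0; set X := _ :|: _; set Y := [set z | _] in He *.
  have cX : #|X| <= #|V| + #|F| + #|F|.
    apply: leq_trans (leq_card_setU _ _) _; rewrite leq_add //.
      apply: leq_trans (leq_card_setU _ _) _; rewrite leq_add //.
        by rewrite -cardsT leq_imset_card.
      exact: leq_trans (leq_imset_card _ _) cBF.
    apply: leq_trans (card_bigcup_le _ _) _; apply: leq_trans cBF.
    by rewrite -sum1_card; apply: leq_sum => b _.
  have := subset_leq_card (subsetIr Y X); rewrite cardsD; lia.
rewrite !inE => /andP[/norP[/norP[zg zh] zbad] zG].
pose h1 b := if b == e then z else h b.
have h1e : h1 e = z by rewrite /h1 eqxx.
have h1B b : b \in B -> h1 b = h b.
  by rewrite /h1; case: eqP => // ->; rewrite (negPf eB).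
apply: (IHn (e |: B) h1).
- move: En; rewrite [in X in X -> _](cardsD1 e) !inE eB eF add1n => -[<-].
  by apply: eq_card => b; rewrite !inE negb_or andbA.
- by rewrite subUset sub1set eF.
- by move=> b /setU1P[->|bB]; rewrite ?h1e // h1B // hg.
- move=> a b /setU1P[->|aB] /setU1P[->|bB]; rewrite ?h1e ?(h1B a) ?(h1B b) //.
  + by move=> E; rewrite E imset_f in zh.
  + by move=> E; rewrite -E imset_f in zh.
  exact: injh.
- have no b : b \in B -> c (z |: g @: e) <> c (h b |: g @: b).
    move=> bB E; case/bigcupP: zbad; exists b => //.
    by rewrite inE zG /=; apply/eqP.
  move=> a b /setU1P[->|aB] /setU1P[->|bB]; rewrite ?h1e ?(h1B a) ?(h1B b) //.
  + by move/no => /(_ bB).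
  + by move/esym/no => /(_ aB).
  exact: injc.
by move=> b bF; rewrite !inE negb_or => /andP[_ bB]; apply: heavy.
Qed.

End Embedding.

(** * Rainbow-free colorings and doubly edge-critical graphs *)

Lemma exists_fresh (T : finType) (A X : {set T}) : #|X| < #|A| ->
  exists x, x \in A /\ x \notin X.
Proof.
move=> lt; have [x] : exists x, x \in A :\: X.
  apply/set0Pn; rewrite -card_gt0 cardsD.
  have := subset_leq_card (subsetIr A X); lia.
by case/setDP=> xA xX; exists x.
Qed.

Lemma cardsU1_le (T : finType) (x : T) (X : {set T}) n :
  #|X| <= n -> #|x |: X| <= n.+1.
Proof. by rewrite cardsU1 -add1n => Xn; rewrite leq_add // leq_b1. Qed.

Lemma uniq_shuffle5 (T : eqType) (z w x y u : T) :
  uniq [:: z; w; x; y; u] = uniq [:: w; u; x; y; z].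
Proof. by apply: perm_uniq; apply/seq.permP => q /=; lia. Qed.

Lemma uniq_shuffle6 (T : eqType) (z w x y u v : T) :
  uniq [:: z; w; x; y; u; v] = uniq [:: w; v; u; x; y; z].
Proof. by apply: perm_uniq; apply/seq.permP => q /=; lia. Qed.

Lemma uniform2P (V : finType) (F : {set {set V}}) e : uniform 2 F -> e \in F ->
  exists a b, a != b /\ e = [set a; b].
Proof.
by move=> /forall_inP F2 /F2 /cards2P.
Qed.

(** Moves the parts of the two critical edges to prescribed parts with the same pattern of
    coincidence. *)
Lemma relabel_parts (K : finType) (a b i j : K) : (a == b) = (i == j) ->
  exists s : K -> K, [/\ injective s, s a = i & s b = j].
Proof.
move=> ab; pose b1 := tperm a i b.
exists (fun x => tperm b1 j (tperm a i x)); split.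
- by move=> x y /perm_inj/perm_inj.
- rewrite tpermL; have [ab'|ab'] := eqVneq a b.
    by rewrite -(eqP (_ : i == j)) -?ab ?ab' // /b1 -ab' tpermL tperm1 perm1.
  rewrite tpermD // eq_sym -?ab ?(negPf ab') //.
  by rewrite /b1 -[i in i == _](tpermL a i) (inj_eq perm_inj).
by rewrite -/b1 tpermL.
Qed.

(** * Partitions of a doubly edge-critical graph *)

Section Critical.
Variables (k : nat) (V : finType) (F : {set {set V}}).
Hypothesis F2 : uniform 2 F.

Lemma proper_coloringP (E : {set {set V}}) m (f : {ffun V -> 'I_m}) :
  reflect (forall x y, x != y -> [set x; y] \in E -> f x != f y)
          (proper_coloring E f).
Proof.
apply: (iffP 'forall_forallP) => H x y; last by apply/implyP => /andP[]; apply: H.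
by move=> xy xyE; have /implyP -> := H x y; rewrite ?xy.
Qed.

Hypothesis crit : doubly_edge_critical k.+1 F.

Lemma not_colorable_del e : e \in F -> ~~ colorable (F :\ e) k.
Proof.
case: crit => /(_ e) H _ /H; rewrite /chi; case: ex_minnP => m _ min.
by apply: contraL => /min; rewrite -leqNgt.
Qed.

(** A [k]-coloring of [F] less two critical edges leaves both of them monochromatic: otherwise it
    would properly color [F] less a single edge. *)
Lemma critical_partition : exists (P : V -> 'I_k) (a a' b b' : V),
  [/\ a != a', b != b', [set a; a'] \in F, [set b; b'] \in F
    & [set a; a'] != [set b; b']] /\
  [/\ P a = P a', P b = P b' &
  forall v w, v != w -> [set v; w] \in F -> [set v; w] != [set a; a'] ->
    [set v; w] != [set b; b'] -> P v != P w].
Proof.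
case: (crit) => _ [e1 [e2 [e1F e2F e12]]] /=; rewrite /chi.
case: ex_minnP => m + _ /esym Em; rewrite -{}Em => /existsP[f /proper_coloringP fP].
have [a [a' [aa' E1]]] := uniform2P F2 e1F.
have [b [b' [bb' E2]]] := uniform2P F2 e2F.
exists f, a, a', b, b'; rewrite -E1 -E2; split=> //; split.
- apply/eqP; apply/negPn/negP => faa.
  have /negP := not_colorable_del e2F; apply; apply/existsP; exists f.
  apply/proper_coloringP => x y xy; rewrite 2!inE => /andP[xy2 xyF].
  have [xy1|xy1] := eqVneq [set x; y] e1; last first.
    by apply: fP => //; rewrite !inE xy1 xy2.
  have : (x \in e1) && (y \in e1) by rewrite -xy1 set21 set22.
  rewrite E1 !inE => /andP[/orP[]/eqP xE /orP[]/eqP yE]; move: xy; rewrite xE yE ?eqxx //.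
  by move=> _; rewrite eq_sym.
- apply/eqP; apply/negPn/negP => fbb.
  have /negP := not_colorable_del e1F; apply; apply/existsP; exists f.
  apply/proper_coloringP => x y xy; rewrite 2!inE => /andP[xy1 xyF].
  have [xy2|xy2] := eqVneq [set x; y] e2; last first.
    by apply: fP => //; rewrite !inE xy1 xy2.
  have : (x \in e2) && (y \in e2) by rewrite -xy2 set21 set22.
  rewrite E2 !inE => /andP[/orP[]/eqP xE /orP[]/eqP yE]; move: xy; rewrite xE yE ?eqxx //.
  by move=> _; rewrite eq_sym.
by move=> v w vw vwF vw1 vw2; apply: fP => //; rewrite !inE vw1 vw2.
Qed.

End Critical.

(* Codegree that leaves the greedy completion a fresh vertex and a fresh color. *)
Definition heavy_bound (V : finType) (F : {set {set V}}) := #|V| + 2 * #|F|.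

Definition heavy (T : finType) (G : {set {set T}}) (C : nat) : rel T :=
  fun x y => C < #|[set z | z |: [set x; y] \in G]|.

Lemma heavy_sym (T : finType) (G : {set {set T}}) C : symmetric (heavy G C).
Proof. by move=> x y; rewrite /heavy setUC. Qed.

Lemma heavy_irr (T : finType) (G : {set {set T}}) C :
  G \subset triples T -> irreflexive (heavy G C).
Proof.
move=> G3 x; rewrite /heavy (_ : [set z | _] = set0) ?cards0 //.
apply/setP => z; rewrite !inE setUid; apply/negP => /(subsetP G3).
by rewrite inE cardsU1 cards1; case: (_ \notin _).
Qed.

(** * Forbidden configurations in a rainbow-free coloring *)

Section NoRainbow.
Variables (k : nat) (V T : finType) (F : {set {set V}}) (c : {set T} -> nat).
Variable (G : {set {set T}}).
Hypothesis F2 : uniform 2 F.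
Hypothesis crit : doubly_edge_critical k.+1 F.
Hypothesis G3 : G \subset triples T.
Hypothesis cG : {in G &, injective c}.
Hypothesis norb : ~ has_rainbow (triples T) c (expansion 3 F).

Local Notation C := (heavy_bound F).
Local Notation H := (heavy G C).

Lemma no_embedding (B : {set {set V}}) (g : V -> T) (h : {set V} -> T) :
  injective g -> B \subset F -> {in B, forall e, h e \notin g @: setT} ->
  {in B &, injective h} ->
  {in B &, injective (fun e => c (h e |: g @: e))} ->
  (forall v w, v != w -> [set v; w] \in F :\: B -> H (g v) (g w)) -> False.
Proof.
move=> injg BF hg injh injc Hg; apply: norb.
apply: (rainbow_completion F2 G3 cG injg BF hg injh injc) => e eF eB.
have [a [b [ab E]]] := uniform2P F2 eF; rewrite E imsetU1 imset_set1.
by apply: Hg; rewrite // -E inE eF eB.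
Qed.

Lemma no_join (x : T) (R : 'I_k -> {set T}) m :
  (forall i, R i \subset nbr H x) ->
  (forall i j, i != j -> forall y, y \in R j -> #|R i :\: nbr H y| <= m) ->
  (forall i, #|V| * m + #|V| < #|R i|) -> False.
Proof.
move=> Rx Rm Rbig.
have [P [a [a' [b [b' [[aa' bb' aF bF ab] [Paa Pbb PF]]]]]]] := critical_partition F2 crit.
pose e : rel V := fun v w => (v != w) && ([set v; w] \in F :\ [set b; b']).
have symE : symmetric e by move=> v w; rewrite /e eq_sym setUC.
have irrE : irreflexive e by move=> v; rewrite /e eqxx.
have [|||v|g [gi ga gR gH]] := @greedy_extension V T e H (fun v => R (P v)) set0 m
   [set a] (fun _ => x) symE irrE (heavy_sym _ _).
- by move=> u w /set1P-> /set1P->.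
- move=> v w _ _ _; rewrite (_ : _ :\: _ = set0) ?cards0 //.
  by apply/eqP; rewrite setD_eq0.
- move=> v w; rewrite !inE => va wa /andP[vw /setD1P[vwb vwF]]; apply: Rm.
  apply: PF => //; apply: contraNneq va => E.
  have : a \in [set v; w] by rewrite E set21.
  by rewrite !inE eq_sym [a == w]eq_sym (negPf wa) orbF.
- by rewrite cards0 addn0.
have [z [_ zg]] : exists z, z \in [set: T] /\ z \notin g @: setT.
  apply: exists_fresh; rewrite cardsT; apply: leq_ltn_trans (leq_imset_card _ _) _.
  rewrite cardsT; have := subset_leq_card (subsetT (R (P a))); rewrite cardsT.
  have := Rbig (P a); lia.
apply: (@no_embedding [set [set b; b']] g (fun _ => z)) => //.
- by rewrite sub1set.
- by move=> u w /set1P-> /set1P->.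
- by move=> u w /set1P-> /set1P->.
move=> v w vw vwF; have [va|va] := boolP (v \in [set a]); last by apply: gH; rewrite // /e vw.
rewrite heavy_sym; apply: gH; last by rewrite symE /e vw.
by move: va; rewrite !inE => /eqP <-; rewrite eq_sym.
Qed.

Variables (W : 'I_k -> {set T}) (m : nat).
(** [x] behaves toward the other parts like a member of part [i], whether or not it lies in
    [W i]. *)
Definition typical i x := forall j, j != i -> #|W j :\: nbr H x| <= m.
Hypothesis Wtyp : forall i x, x \in W i -> typical i x.
Hypothesis Wbig : forall i, #|V| * m + 4 * m + #|V| + #|F| + 20 < #|W i|.

(** Placing the vertices outside [D] greedily in the parts [W] assigned by [P], off the apexes
    prescribed for [B], would complete a rainbow copy. *)
Lemma no_prescribed (P : V -> 'I_k) (D : {set V}) (g0 : V -> T)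
    (B : {set {set V}}) (h : {set V} -> T) :
  {in D &, injective g0} -> B \subset F -> {in B, forall e : {set V}, e \subset D} ->
  (forall v w, v != w -> [set v; w] \in F :\: B -> P v != P w) ->
  {in D, forall v, typical (P v) (g0 v)} ->
  (forall v w, v \in D -> w \in D -> v != w -> [set v; w] \in F :\: B ->
    H (g0 v) (g0 w)) ->
  {in B, forall e, h e \notin g0 @: D} -> {in B &, injective h} ->
  {in B &, injective (fun e => c (h e |: g0 @: e))} -> False.
Proof.
move=> g0i BF BD PF typD HD hg0 injh injc.
pose e : rel V := fun v w => (v != w) && ([set v; w] \in F :\: B).
have symE : symmetric e by move=> v w; rewrite /e eq_sym setUC.
have irrE : irreflexive e by move=> v; rewrite /e eqxx.
have [||v vD|g [gi ga gR gH]] := @greedy_extension V T e H (fun v => W (P v)) (h @: B) m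
   D g0 symE irrE (heavy_sym _ _) g0i.
- by move=> v w _ wD /andP[vw vwF]; apply: typD => //; apply: PF.
- by move=> v w _ wD /andP[vw vwF] x xW; apply: Wtyp xW _ _; apply: PF.
- have cB : #|h @: B| <= #|F| := leq_trans (leq_imset_card _ _) (subset_leq_card BF).
  by have := Wbig (P v); lia.
have ge b : b \in B -> g @: b = g0 @: b.
  by move=> bB; apply: eq_in_imset => v /(subsetP (BD _ bB)); apply: ga.
apply: (@no_embedding B g h) => //.
- move=> b bB; apply/imsetP => -[v _ E]; have [vD|vD] := boolP (v \in D).
    by have /negP := hg0 b bB; apply; rewrite E ga // imset_f.
  by have := gR v vD; rewrite -E inE imset_f.
- by move=> b b' bB b'B; rewrite !ge //; apply: injc.
move=> v w vw vwF; have [vD|vD] := boolP (v \in D); last by apply: gH; rewrite // /e vw.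
have [wD|wD] := boolP (w \in D); first by rewrite !ga //; apply: HD.
by rewrite heavy_sym; apply: gH; rewrite // symE /e vw.
Qed.

(** With different colors these triples could serve for the two critical edges. The lists [s] and
    [t] encode the placement of the endpoints, so that disjoint and intersecting critical edges are
    treated alike. *)
Lemma two_triples (P : V -> 'I_k) a a' b b' (s : seq V) (t : seq T) z w
    (g0 := fun v => nth z t (index v s)) :
  [set a; a'] \in F -> [set b; b'] \in F -> [set a; a'] != [set b; b'] ->
  (forall v w, v != w -> [set v; w] \in F -> [set v; w] != [set a; a'] ->
    [set v; w] != [set b; b'] -> P v != P w) ->
  uniq s -> uniq t -> size s = size t -> {subset [:: a; a'; b; b'] <= s} ->
  (forall v, v \in s -> typical (P v) (g0 v)) ->
  (forall v w, v \in s -> w \in s -> P v != P w -> H (g0 v) (g0 w)) ->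
  uniq [:: z, w & t] ->
  c (z |: [set g0 a; g0 a']) = c (w |: [set g0 b; g0 b']).
Proof.
move=> aF bF ab PF us ut st abs typ Hg /= /and3P[]; rewrite inE negb_or => /andP[zw zt] wt _.
have [//|/eqP cab] := eqVneq (c (z |: [set g0 a; g0 a'])) (c (w |: [set g0 b; g0 b'])).
have gt v : v \in s -> g0 v \in t by move=> vs; rewrite mem_nth // -st index_mem.
pose h e := if e == [set a; a'] then z else w.
have ha : h [set a; a'] = z by rewrite /h eqxx.
have hb : h [set b; b'] = w by rewrite /h eq_sym (negPf ab).
have PB v u : v != u -> [set v; u] \in F :\: [set [set a; a']; [set b; b']] -> P v != P u.
  move=> vu; rewrite inE !in_set2 negb_or => /andP[/andP[]]; do 2 move=> ?; move=> ?; exact: PF.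
exfalso; apply: (@no_prescribed P [set v in s] g0 [set [set a; a']; [set b; b']] h).
- move=> v u; rewrite !inE => vs us' /eqP; rewrite nth_uniq -?st ?index_mem //.
  by move=> E; have := @index_inj _ v s _ _ vs us'; apply; apply/eqP.
- by apply/subsetP => e; rewrite in_set2 => /orP[]/eqP->.
- by move=> e; rewrite in_set2 => /orP[]/eqP->; apply/subsetP => v; rewrite !inE;
    case/orP=> /eqP->; apply: abs; rewrite !inE eqxx ?orbT.
- exact: PB.
- by move=> v; rewrite inE; apply: typ.
- move=> v u vD uD vu vuF; rewrite !inE in vD uD; apply: Hg => //; exact: PB.
- move=> e; rewrite in_set2 => /orP[]/eqP->; rewrite ?ha ?hb; apply/imsetP => -[v];
    rewrite inE => /gt + E; rewrite -E ?(negPf zt) ?(negPf wt) //.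
- by move=> e e'; rewrite !in_set2 => /orP[]/eqP-> /orP[]/eqP->; rewrite ?ha ?hb // => E;
    move: zw; rewrite E eqxx.
move=> e e'; rewrite !in_set2 => /orP[]/eqP-> /orP[]/eqP->; rewrite ?ha ?hb //;
  rewrite !imsetU1 !imset_set1 => // E; case: cab; rewrite E //.
Qed.

(** [4 * m] covers the non-neighbors of the four typical vertices of two triples, the constant the
    vertices in use. *)
Lemma fresh_in_part j (Y : {set T}) n : #|Y| <= n -> n <= 10 + 4 * m ->
  exists u, u \in W j /\ u \notin Y.
Proof.
move=> Yn n10; apply: exists_fresh; apply: leq_ltn_trans Yn _.
by have := Wbig j; lia.
Qed.

Lemma triple_set (x y z : T) : [set x; y; z] = z |: [set x; y].
Proof. by rewrite setUC. Qed.

(* Both triples are compared to a third, generic one: if its color differed from that of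
   one of them, these two could play the two critical edges of [F]. *)
Lemma same_part_same_color i x1 y1 z1 x2 y2 z2 :
  uniq [:: x1; y1; z1] -> uniq [:: x2; y2; z2] ->
  typical i x1 -> typical i y1 -> typical i x2 -> typical i y2 ->
  c [set x1; y1; z1] = c [set x2; y2; z2].
Proof.
have [P [a [a' [b [b' [[aa' bb' aF bF ab] [Paa Pbb PF]]]]]]] := critical_partition F2 crit.
have Psig (s : 'I_k -> 'I_k) : injective s -> forall v w, v != w -> [set v; w] \in F ->
    [set v; w] != [set a; a'] -> [set v; w] != [set b; b'] -> s (P v) != s (P w).
  by move=> si v w vw vwF va vb; rewrite (inj_eq si) PF.
(* Disjoint critical edges: the pairs lie in parts [i] and [j], equal exactly when the critical
   edges lie in the same part of [P]. *)
have dis : uniq [:: a; a'; b; b'] -> forall j x y z u u' w, (P a == P b) = (i == j) ->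
    uniq [:: z; w; x; y; u; u'] -> typical i x -> typical i y -> typical j u -> typical j u' ->
    (i != j -> [/\ H x u, H x u', H y u & H y u']) ->
    c [set x; y; z] = c [set u; u'; w].
  move=> us j x y z u u' w /relabel_parts[s [si sa sb]] ut tx ty tu tu' Hij.
  have g0E (p := fun v => nth z [:: x; y; u; u'] (index v [:: a; a'; b; b'])) :
      [/\ p a = x, p a' = y, p b = u & p b' = u'].
    move: us; rewrite /p /= !inE !negb_or => /and3P[/and3P[n1 n2 n3] /andP[n4 n5] /andP[n6 _]].
    by rewrite !eqxx (negPf n1) (negPf n2) (negPf n3) (negPf n4) (negPf n5) (negPf n6).
  case: g0E => ga ga' gb gb'.
  have := @two_triples (s \o P) a a' b b' [:: a; a'; b; b'] [:: x; y; u; u'] z w aF bF ab.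
  rewrite ga ga' gb gb' !triple_set; apply=> //.
  - exact: Psig.
  - by case/and3P: ut.
  - by move=> v; rewrite !inE => /or4P[]/eqP->; rewrite /= -?Paa -?Pbb ?sa ?sb ?ga ?ga' ?gb ?gb'.
  - move=> v v'; rewrite !inE => /or4P[]/eqP-> /or4P[]/eqP->;
      rewrite /= -?Paa -?Pbb ?sa ?sb ?ga ?ga' ?gb ?gb' ?eqxx // => ij;
      do ?[by case: (Hij ij)]; rewrite eq_sym in ij;
      by rewrite heavy_sym; case: (Hij ij).
(* Critical edges with a common endpoint lie in the same part and give triples sharing the vertex
   [x]. *)
have share a0 a1 d : [set a; a'] = [set a0; a1] -> [set b; b'] = [set a0; d] ->
    uniq [:: a0; a1; d] -> P a0 = P a1 -> P a0 = P d ->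
    forall x y z u w, uniq [:: z; w; x; y; u] -> typical i x -> typical i y -> typical i u ->
    c [set x; y; z] = c [set x; u; w].
  move=> E1 E2 us Pa Pd x y z u w ut tx ty tu.
  have [s [si sa _]] : exists s : 'I_k -> 'I_k, [/\ injective s, s (P a0) = i & s (P a0) = i].
    by apply: relabel_parts; rewrite !eqxx.
  have g0E (p := fun v => nth z [:: x; y; u] (index v [:: a0; a1; d])) :
      [/\ p a0 = x, p a1 = y & p d = u].
    move: us; rewrite /p /= !inE !negb_or => /and3P[/andP[n1 n2] n3 _].
    by rewrite !eqxx (negPf n1) (negPf n2) (negPf n3).
  case: g0E => ga ga' gd; rewrite E1 in aF ab PF Psig; rewrite E2 in bF ab PF Psig.
  have := @two_triples (s \o P) a0 a1 a0 d [:: a0; a1; d] [:: x; y; u] z w aF bF ab.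
  rewrite ga ga' gd !triple_set; apply=> //.
  - exact: Psig.
  - by case/and3P: ut.
  - by move=> v; rewrite !inE => /or4P[]/eqP->; rewrite eqxx ?orbT.
  - by move=> v; rewrite !inE => /or3P[]/eqP->; rewrite /= -?Pa -?Pd ?sa ?ga ?ga' ?gd.
  - by move=> v v'; rewrite !inE => /or3P[]/eqP-> /or3P[]/eqP->;
      rewrite /= -?Pa -?Pd ?sa eqxx.
move=> u1 u2 tx1 ty1 tx2 ty2.
pose l1 := [:: x1; y1; z1]; pose l2 := [:: x2; y2; z2]; pose s6 := l1 ++ l2.
have sl1 : {subset l1 <= s6} by move=> x xl; rewrite mem_cat xl.
have sl2 : {subset l2 <= s6} by move=> x xl; rewrite mem_cat xl orbT.
have cs6 : #|[set x in s6]| <= 6 by rewrite cardsE; apply: leq_trans (card_size _) _.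
have [us|nus] := boolP (uniq [:: a; a'; b; b']).
  have [j Ej] : exists j, (P a == P b) = (i == j).
    have [_|Pab] := eqVneq (P a) (P b); first by exists i; rewrite eqxx.
    have [iE|iE] := eqVneq i (P a); last by exists (P a); rewrite (negPf iE).
    by exists (P b); rewrite iE (negPf Pab).
  pose N x : {set T} := if i == j then set0 else W j :\: nbr H x.
  have cN x : typical i x -> #|N x| <= m.
    move=> tx; rewrite /N; case: eqP => [|/eqP ij]; first by rewrite cards0.
    by apply: tx; rewrite eq_sym.
  have HN x u : u \in W j -> u \notin N x -> i != j -> H x u.
    by rewrite /N => uW + /negPf ij; rewrite ij !inE uW andbT negbK.
  pose X := [set x in s6] :|: (N x1 :|: N y1 :|: (N x2 :|: N y2)).
  have cX : #|X| <= 6 + (m + m + (m + m)).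
    apply: leq_trans (leq_card_setU _ _) _; rewrite leq_add //.
    by do 2 (apply: leq_trans (leq_card_setU _ _) _; rewrite leq_add ?cN //;
      try (apply: leq_trans (leq_card_setU _ _) _; rewrite leq_add ?cN //)).
  have [u [uW uX]] : exists u, u \in W j /\ u \notin X.
    by apply: fresh_in_part cX _; clear; lia.
  have [u' [u'W u'X]] : exists u', u' \in W j /\ u' \notin u |: X.
    by apply: fresh_in_part (cardsU1_le _ cX) _; clear; lia.
  have cX' := cardsU1_le u cX.
  have [w [wW wX]] : exists w, w \in W j /\ w \notin u' |: (u |: X).
    by apply: fresh_in_part (cardsU1_le _ cX') _; clear; lia.
  have UQ l : uniq l -> {subset l <= s6} -> uniq [:: w, u', u & l].
    move=> ul sl /=; rewrite ul andbT !inE !negb_or.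
    move: wX; rewrite in_setU1 negb_or in_setU1 negb_or in_setU negb_or inE.
    case/and3P=> -> -> /andP[wl _] /=.
    move: u'X; rewrite in_setU1 negb_or in_setU negb_or inE => /and3P[-> u'l _] /=.
    move: uX; rewrite in_setU negb_or inE => /andP[ul6 _].
    by rewrite (contraNN (sl _) wl) (contraNN (sl _) u'l) (contraNN (sl _) ul6).
  have {}HN x u0 : x \in [:: x1; y1; x2; y2] -> u0 \in W j -> u0 \notin X -> i != j -> H x u0.
    move=> xl u0W u0X; apply: HN => //; apply: contraNN u0X.
    by rewrite in_setU !(in_setU _ (N _ :|: N _)) !(in_setU _ (N _)); move: xl; rewrite !inE;
      case/or4P=> /eqP-> ->; rewrite ?orbT.
  have u'X2 : u' \notin X by move: u'X; rewrite in_setU1 negb_or => /andP[].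
  have [M1 M2 M3 M4] : [/\ x1 \in [:: x1; y1; x2; y2], y1 \in [:: x1; y1; x2; y2],
      x2 \in [:: x1; y1; x2; y2] & y2 \in [:: x1; y1; x2; y2]].
    by split; rewrite !inE eqxx ?orbT.
  transitivity (c [set u; u'; w]); [|symmetry]; (apply: (dis us) Ej _ _ _ _ _ _;
     [|by []|by []|exact: Wtyp|exact: Wtyp|]).
  - by rewrite uniq_shuffle6 UQ.
  - by move=> ij; split; apply: HN.
  - by rewrite uniq_shuffle6 UQ.
  - by move=> ij; split; apply: HN.
have [a0 [a1 [d [E1 E2 us [Pa Pd]]]]] : exists a0 a1 d, [/\ [set a; a'] = [set a0; a1],
    [set b; b'] = [set a0; d], uniq [:: a0; a1; d] & P a0 = P a1 /\ P a0 = P d].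
  have key a0 a1 d : [set a; a'] = [set a0; a1] -> [set b; b'] = [set a0; d] ->
      a0 != a1 -> a0 != d -> uniq [:: a0; a1; d].
    move=> Ea Eb n1 n2; rewrite /= !inE negb_or n1 n2 /= andbT.
    by apply: contra_neq ab => E; rewrite Ea Eb E.
  have sC (x y : V) : [set x; y] = [set y; x] by rewrite setUC.
  have : [|| a == b, a == b', a' == b | a' == b'].
    apply: contraR nus; rewrite !negb_or => /and4P[n1 n2 n3 n4].
    by rewrite /= !inE !negb_or aa' bb' n1 n2 n3 n4.
  case/or4P => /eqP E.
  - have Eb : [set b; b'] = [set a; b'] by rewrite E.
    by exists a, a', b'; split=> //; [apply: key; rewrite // E|rewrite -Paa E].
  - have Eb : [set b; b'] = [set a; b] by rewrite E sC.
    by exists a, a', b; split=> //; [apply: key; rewrite // E eq_sym|rewrite -Paa Pbb E].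
  - have Ea := sC a a'; have Eb : [set b; b'] = [set a'; b'] by rewrite E.
    exists a', a, b'; split=> //; last by rewrite Paa -Pbb E.
    by apply: key; rewrite // ?E // -E eq_sym.
  have Ea := sC a a'; have Eb : [set b; b'] = [set a'; b] by rewrite E sC.
  exists a', a, b; split=> //; last by rewrite Paa Pbb E.
  by apply: key; rewrite // eq_sym // E.
have {dis} share := share _ _ _ E1 E2 us Pa Pd.
(* Triples sharing a typical vertex are compared through a generic triple at that vertex, the others
   ([apart]) through a triple containing a typical vertex of each. *)
have common x y z y' z' : uniq [:: x; y; z] -> uniq [:: x; y'; z'] ->
    typical i x -> typical i y -> typical i y' -> c [set x; y; z] = c [set x; y'; z'].
  move=> v1 v2 tx ty ty'; pose l := [:: x; y; z; y'; z'].
  have cl : #|[set x in l]| <= 5 by rewrite cardsE; apply: leq_trans (card_size _) _.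
  have [u [uW uX]] : exists u, u \in W i /\ u \notin [set x in l].
    by apply: fresh_in_part cl _; clear; lia.
  have [w [wW wX]] : exists w, w \in W i /\ w \notin u |: [set x in l].
    by apply: fresh_in_part (cardsU1_le _ cl) _; clear; lia.
  have UQ l' : uniq l' -> {subset l' <= l} -> uniq [:: w, u & l'].
    move=> ul sl /=; rewrite ul andbT !inE !negb_or.
    move: wX; rewrite in_setU1 negb_or inE => /andP[-> wl].
    by rewrite inE in uX; rewrite (contraNN (sl _) wl) (contraNN (sl _) uX).
  transitivity (c [set x; u; w]); [|symmetry]; (apply: share; [|by []|by []|exact: Wtyp]).
  - rewrite uniq_shuffle5 UQ //.
    by move=> v; rewrite !inE => /or3P[]->; rewrite ?orbT.
  - rewrite uniq_shuffle5 UQ //.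
    by move=> v; rewrite !inE => /or3P[]->; rewrite ?orbT.
have apart x y z x' y' z' : uniq [:: x; y; z] -> uniq [:: x'; y'; z'] ->
    x' \notin [:: x; y; z] -> x \notin [:: x'; y'; z'] ->
    typical i x -> typical i y -> typical i x' -> typical i y' ->
    c [set x; y; z] = c [set x'; y'; z'].
  move=> v1 v2 x'n xn tx ty tx' ty'; pose l := [:: x; y; z; x'; y'; z'].
  have cl : #|[set x in l]| <= 6 by rewrite cardsE; apply: leq_trans (card_size _) _.
  have [w [wW wX]] : exists u, u \in W i /\ u \notin [set x in l].
    by apply: fresh_in_part cl _; clear; lia.
  have UQ v l' : uniq l' -> {subset v :: l' <= l} -> v \notin l' -> uniq [:: w, v & l'].
    move=> ul sl vl; have /= -> : uniq (v :: l') by rewrite /= vl.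
    by rewrite inE in wX; rewrite (contraNN (sl _) wX).
  transitivity (c [set x; x'; w]); [|rewrite (setUC [set x]); symmetry];
    (apply: share; [|by []|by []|by []]).
  - rewrite uniq_shuffle5 UQ //.
    by move=> v; rewrite !inE => /or4P[]->; rewrite ?orbT.
  - rewrite uniq_shuffle5 UQ //.
    by move=> v; rewrite !inE => /or4P[]->; rewrite ?orbT.
have sw (x y z : T) : [set x; y; z] = [set y; x; z] by rewrite (setUC [set x]).
have uw (x y z : T) : uniq [:: x; y; z] -> uniq [:: y; x; z].
  by rewrite /= !inE !negb_or (eq_sym x y) => /and3P[/andP[-> ->] -> _].
have [E|n11] := eqVneq x1 x2; first by rewrite -E in u2 *; apply: common.
have [E|n12] := eqVneq x1 y2; first by rewrite (sw x2) -E; apply: common; rewrite // E uw.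
have [E|n21] := eqVneq y1 x2; first by rewrite (sw x1) E; apply: common; rewrite // -E uw.
have [E|n22] := eqVneq y1 y2.
  by rewrite (sw x1) (sw x2) E; apply: common; rewrite // -?E uw // E.
(* Exchanging the two typical vertices if necessary, the first one lies outside the other triple, as
   [apart] requires. *)
have [p [q [Ep up tp tq [pz px py [qx qy]]]]] : exists p q, [/\ [set x1; y1; z1] = [set p; q; z1],
    uniq [:: p; q; z1], typical i p, typical i q &
    [/\ p != z2, p != x2, p != y2 & q != x2 /\ q != y2]].
  have [E|n] := eqVneq x1 z2; last by exists x1, y1; split.
  exists y1, x1; split=> //; first exact: uw.
  by split; rewrite // -E; move: u1; rewrite /= !inE negb_or eq_sym => /and3P[/andP[]].
have [p' [q' [Ep' up' tp' tq' [p'z p'p p'q [q'p q'q]]]]] : exists p' q',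
    [/\ [set x2; y2; z2] = [set p'; q'; z2],
    uniq [:: p'; q'; z2], typical i p', typical i q' &
    [/\ p' != z1, p != p', q != p' & p != q' /\ q != q']].
  have [E|n] := eqVneq x2 z1; last by exists x2, y2; split.
  exists y2, x2; split=> //; first exact: uw.
  by split; rewrite // -E; move: u2; rewrite /= !inE negb_or eq_sym => /and3P[/andP[]].
rewrite Ep Ep'; apply: apart => //; rewrite !inE !negb_or.
  by rewrite p'z !(eq_sym p') p'p p'q.
by rewrite p'p q'p pz.
Qed.

(** [F] embeds with its part [i] inside [W (s i)]. Edges of [B] stay inside parts and receive the
    distinct colors [gamma], at most one edge per part; the other edges become heavy pairs. *)
Lemma no_class_partition (P : V -> 'I_k) (s : 'I_k -> 'I_k) (B : {set {set V}})
    (part : {set V} -> 'I_k) (gamma : 'I_k -> nat) (J : {set 'I_k}) :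
  injective s -> B \subset F ->
  (forall v w, v != w -> [set v; w] \in F :\: B -> P v != P w) ->
  {in B, forall (e : {set V}) v, v \in e -> P v = part e} ->
  {in B &, injective part} -> {in B, forall e, s (part e) \in J} ->
  {in J &, injective gamma} ->
  {in J, forall j x y z, x \in W j -> y \in W j -> uniq [:: x; y; z] ->
    c [set x; y; z] = gamma j} -> False.
Proof.
move=> si BF PF Bpart injp BJ injg WJ.
have [P0 [a _]] := critical_partition F2 crit.
have [x0 _] : exists x, x \in W (P a).
  by apply/set0Pn; rewrite -card_gt0; have := Wbig (P a); lia.
pose e : rel V := fun v w => (v != w) && ([set v; w] \in F :\: B).
have symE : symmetric e by move=> v w; rewrite /e eq_sym setUC.
have irrE : irreflexive e by move=> v; rewrite /e eqxx.
have [||||g [gi _ gR gH]] := @greedy_extension V T e H (fun v => W (s (P v))) set0 m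
   set0 (fun=> x0) symE irrE (heavy_sym _ _).
- by move=> v w; rewrite inE.
- by move=> v w; rewrite [w \in _]inE.
- move=> v w _ _ /andP[vw vwF] x xW; apply: Wtyp xW _ _.
  by rewrite (inj_eq si) PF.
- by move=> v _; rewrite cards0; have := Wbig (s (P v)); lia.
have gW v : g v \in W (s (P v)) by have := gR v; rewrite !inE => /(_ isT) /andP[].
pose Y := enum (~: (g @: setT)).
have cY : #|F| <= size Y.
  have := cardsC (g @: setT); rewrite -cardE -cardsT card_imset // cardsT.
  have := subset_leq_card (subsetT (W (P a))); rewrite cardsT.
  have := Wbig (P a); lia.
(* Apexes outside the copy, indexed by the edges so as to be distinct. *)
pose h b := nth x0 Y (index b (enum F)).
have hY b : b \in B -> index b (enum F) < size Y.
  move=> /(subsetP BF) bF; apply: leq_trans cY.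
  by rewrite cardE index_mem mem_enum.
apply: (@no_embedding B g h) => //.
- by move=> b bB; rewrite -in_setC -mem_enum mem_nth // hY.
- move=> b b' bB b'B /eqP; rewrite nth_uniq ?enum_uniq ?hY //.
  move/eqP=> E; have := @index_inj _ b (enum F) b b'; apply=> //;
    by rewrite mem_enum (subsetP BF).
- move=> b b' bB b'B.
  have key d : d \in B -> c (h d |: g @: d) = gamma (s (part d)).
    move=> dB; have [v [w [vw E]]] := uniform2P F2 (subsetP BF _ dB).
    have Pv : P v = part d by apply: Bpart; rewrite // E set21.
    have Pw : P w = part d by apply: Bpart; rewrite // E set22.
    have hd : h d \notin g @: setT by rewrite -in_setC -mem_enum mem_nth // hY.
    rewrite {2}E imsetU1 imset_set1 -triple_set.
    apply: WJ; [exact: BJ|by rewrite -Pv|by rewrite -Pw|].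
    rewrite /= !inE negb_or (inj_eq gi) vw /= andbT; apply/andP; split;
    by apply: contraNneq hd => <-; rewrite imset_f.
  rewrite !key // => /(injg _ _ (BJ _ bB) (BJ _ b'B)) /si; exact: injp.
by move=> v w vw vwF; apply: gH; rewrite ?inE // /e vw.
Qed.

End NoRainbow.

(** * Counting crossing triples *)

Section Crossing.
Variables (T : finType) (k : nat) (P : T -> 'I_k).

Definition crossing : {set {set T}} :=
  [set e in triples T | [forall x in e, forall y in e, (x != y) ==> (P x != P y)]].

Definition part i : {set T} := [set x | P x == i].

Definition cross3 x y z : bool := [&& P x != P y, P x != P z & P y != P z].

Lemma crossing3 x y z : uniq [:: x; y; z] -> ([set x; y; z] \in crossing) = cross3 x y z.
Proof.
rewrite /= !inE !negb_or andbT => /andP[/andP[xy xz] yz].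
have -> : #|[set x; y; z]| == 3 by rewrite setUC cardsU1 cards2 xy !inE negb_or ![z == _]eq_sym xz yz.
apply/idP/idP => [/forall_inP H|/and3P[xyP xzP yzP]].
  have Hxy a b : a \in [set x; y; z] -> b \in [set x; y; z] -> a != b -> P a != P b.
    by move=> ai bi ab; have /forall_inP /(_ _ bi) /implyP -> := H _ ai.
  by rewrite /cross3 !Hxy // !inE eqxx ?orbT.
apply/forall_inP => a; rewrite !inE -orbA => /or3P[]/eqP->; apply/forall_inP => b;
  rewrite !inE -orbA => /or3P[]/eqP->; rewrite ?eqxx //; apply/implyP => _ //;
  by rewrite eq_sym.
Qed.

Lemma cross3_uniq x y z : cross3 x y z -> uniq [:: x; y; z].
Proof.
case/and3P=> xy xz yz; rewrite /= !inE negb_or andbT.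
rewrite (contraNneq _ xy) => [|->] //; rewrite (contraNneq _ xz) => [|->] //.
by rewrite (contraNneq _ yz) => [|->].
Qed.

Lemma card3P (e : {set T}) : #|e| = 3 ->
  exists x y z, uniq [:: x; y; z] /\ e = [set x; y; z].
Proof.
move=> e3; have := enum_uniq (mem e); have := mem_enum e.
move: e3; rewrite cardE; case: (enum e) => [|x [|y [|z [|]]]] //= _ me us.
by exists x, y, z; split=> //; apply/setP => v; rewrite -me !inE orbA.
Qed.

Definition ordered_crossing := \sum_x \sum_y \sum_z (cross3 x y z : nat).

Lemma ordered_crossingE : ordered_crossing = 6 * #|crossing|.
Proof.
have -> : ordered_crossing = \sum_(t : T * T * T | cross3 t.1.1 t.1.2 t.2) 1.
  rewrite /ordered_crossing pair_big pair_big /= [RHS]big_mkcond /=.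
  by apply: eq_bigr => t _; case: cross3.
pose f (t : T * T * T) := [set t.1.1; t.1.2; t.2].
rewrite (partition_big f (mem crossing)) /=; last first.
  by move=> [[x y] z] /= H; rewrite crossing3 // cross3_uniq.
rewrite mulnC -sum_nat_const; apply: eq_bigr => e eC; rewrite sum1dep_card.
have e3 : #|e| = 3 by move: eC; rewrite !inE => /andP[/eqP].
have [a [b [d [us E]]]] := card3P e3; rewrite E in eC *.
have := eC; rewrite crossing3 // => /and3P[Pab Pad Pbd].
have [ab ad bd] : [/\ a != b, a != d & b != d].
  by move: us; rewrite /= !inE negb_or => /and3P[/andP[-> ->] ->].
pose L := [:: (a,b,d); (a,d,b); (b,a,d); (b,d,a); (d,a,b); (d,b,a)].
have uL : uniq L.
  rewrite /= !inE !xpair_eqE !eqxx /= ?(eq_sym b a) ?(eq_sym d a) ?(eq_sym d b).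
  by rewrite (negPf ab) (negPf ad) (negPf bd) ?andbF.
rewrite -[6]/(size L) -(card_uniqP uL).
have S1 x y z : [set x; y; z] = [set y; x; z] by rewrite (setUC [set x]).
have S2 x y z : [set x; y; z] = [set x; z; y] by rewrite -!setUA (setUC [set y]).
apply: eq_card => -[[x y] z]; rewrite !inE /f /=; apply/andP/idP => [[H /eqP Exyz]|].
  have := cross3_uniq H; rewrite /= !inE negb_or => /and3P[/andP[/negPf xy /negPf xz] /negPf yz _].
  have : x \in [set a; b; d] by rewrite -Exyz !inE eqxx.
  have : y \in [set a; b; d] by rewrite -Exyz !inE eqxx orbT.
  have : z \in [set a; b; d] by rewrite -Exyz !inE eqxx !orbT.
  rewrite !inE -!orbA !xpair_eqE => /or3P[]/eqP zE /or3P[]/eqP yE /or3P[]/eqP xE;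
    rewrite xE yE zE ?eqxx in xy xz yz *; rewrite ?eqxx ?orbT ?andbT //= in xy xz yz *;
    by rewrite ?orbT.
have sP u v : (P u == P v) = (P v == P u) by rewrite eq_sym.
rewrite /cross3 !xpair_eqE => /or4P[| | |/or3P[]] /andP[/andP[/eqP-> /eqP->] /eqP->];
  rewrite ?Pab ?Pad ?Pbd ?(sP b a) ?(sP d a) ?(sP d b) ?Pab ?Pad ?Pbd; split=> //.
- by rewrite S2.
- by rewrite S1.
- by rewrite S1 S2 S1 S2 S1.
- by rewrite S1 S2.
by rewrite S1 S2 S1.
Qed.

Lemma sum_same_part : \sum_x \sum_y (P x == P y : nat) = \sum_i #|part i| ^ 2.
Proof.
rewrite (partition_big P xpredT) //=; apply: eq_bigr => i _.
rewrite (eq_bigr (fun=> #|part i|)) => [|x /eqP <-].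
  by rewrite sum_nat_const /part cardsE mulnn.
by rewrite -sum1_card big_mkcond [RHS]big_mkcond /=; apply: eq_bigr => y _;
  rewrite inE eq_sym; case: eqP.
Qed.

Lemma sum_same_part3 :
  \sum_x \sum_y \sum_z ((P x == P y) && (P x == P z) : nat) = \sum_i #|part i| ^ 3.
Proof.
rewrite (partition_big P xpredT) //=; apply: eq_bigr => i _.
rewrite (eq_bigr (fun=> #|part i| ^ 2)) => [|x /eqP <-].
  by rewrite sum_nat_const /part cardsE -expnS.
have sumP : \sum_z (P x == P z) = #|part (P x)|.
  by rewrite -sum1_card big_mkcond [RHS]big_mkcond /=; apply: eq_bigr => y _;
    rewrite inE eq_sym; case: eqP.
rewrite -mulnn -{1}sumP big_distrl /=; apply: eq_bigr => y _.
case: (P x == P y); last by rewrite big1.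
by rewrite mul1n -sumP.
Qed.

(** Inclusion-exclusion, term by term: the crossing indicator plus the three indicators of a
    coinciding pair is one plus twice the indicator of a common part. *)
Lemma ordered_crossing_parts :
  ordered_crossing + 3 * #|T| * \sum_i #|part i| ^ 2 =
  #|T| ^ 3 + 2 * \sum_i #|part i| ^ 3.
Proof.
rewrite -sum_same_part -sum_same_part3.
have E1 : \sum_(x : T) \sum_(y : T) \sum_(z : T) (P x == P y : nat) =
    #|T| * \sum_x \sum_y (P x == P y : nat).
  rewrite big_distrr /=; apply: eq_bigr => x _; rewrite big_distrr /=.
  by apply: eq_bigr => y _; rewrite sum_nat_const.
have E2 : \sum_(x : T) \sum_(y : T) \sum_(z : T) (P x == P z : nat) =
    #|T| * \sum_x \sum_y (P x == P y : nat).
  by rewrite -E1; apply: eq_bigr => x _; rewrite exchange_big.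
have E3 : \sum_(x : T) \sum_(y : T) \sum_(z : T) (P y == P z : nat) =
    #|T| * \sum_x \sum_y (P x == P y : nat) by rewrite sum_nat_const.
have E4 : \sum_(x : T) \sum_(y : T) \sum_(z : T) 1 = #|T| ^ 3.
  by rewrite !sum_nat_const muln1.
have E0 m : 3 * #|T| * m = #|T| * m + #|T| * m + #|T| * m by lia.
rewrite E0 -{1}E1 -{1}E2 -E3 -E4 big_distrr /=.
rewrite /ordered_crossing -!big_split /=; apply: eq_bigr => x _.
rewrite big_distrr -!big_split /=; apply: eq_bigr => y _.
rewrite big_distrr -!big_split /=; apply: eq_bigr => z _.
rewrite /cross3; case: (eqVneq (P x) (P y)) => [->|xy] /=.
  by case: eqP.
case: (eqVneq (P x) (P z)) => [<-|xz] /=; first by rewrite eq_sym (negPf xy).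
by case: eqP.
Qed.

End Crossing.

(* [f a = 3 n a^2 - 2 a^3] lies above its chord through [q] and [q + 1]: the difference is
   [(a - q) (a - q - 1) (3 n - 4 q - 2 - 2 a)].  By [ordered_crossing_parts], [n^3] minus
   the sum of [f] over the part sizes counts the ordered crossing triples. *)
Lemma chord_bound n k q a : 2 < k -> k * q <= n -> 2 < n -> 2 * a <= n ->
  2 * a ^ 3 + (3 * n * q ^ 2 + q * (6 * q ^ 2 + 6 * q + 2)) + 3 * n * (2 * q + 1) * a <=
  3 * n * a ^ 2 + (2 * q ^ 3 + 3 * n * (2 * q + 1) * q) + (6 * q ^ 2 + 6 * q + 2) * a.
Proof.
move=> k2 kq n2 an; have q3 : 3 * q <= n by apply: leq_trans kq; rewrite leq_mul2r k2 orbT.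
have [aq|qa] := leqP a q.
  have [d qE] : exists d, q = a + d by exists (q - a); lia.
  have : 0 <= d * d.+1 * (3 * n - (4 * q + 2 + 2 * a)) by [].
  rewrite !expnS !expn0 qE; nia.
have [d aE] : exists d, a = q + d.+1 by exists (a - q.+1); lia.
have [e nE] : exists e, 3 * n = 4 * q + 2 + 2 * a + e by exists (3 * n - (4 * q + 2 + 2 * a)); lia.
rewrite nE !expnS !expn0 aE; nia.
Qed.

(** [q] and [q + 1] are the part sizes of the balanced partition. *)
Lemma chord_eq n q (b : bool) (a := q + b) :
  2 * a ^ 3 + (3 * n * q ^ 2 + q * (6 * q ^ 2 + 6 * q + 2)) + 3 * n * (2 * q + 1) * a =
  3 * n * a ^ 2 + (2 * q ^ 3 + 3 * n * (2 * q + 1) * q) + (6 * q ^ 2 + 6 * q + 2) * a.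
Proof. rewrite /a {a}; case: b; rewrite ?addn0 ?addn1 !expnS !expn0; lia. Qed.

(** * Maximality and increments of the Turan numbers *)

Definition residue k (k0 : 0 < k) n (x : 'I_n) : 'I_k := Ordinal (ltn_pmod x k0).

Lemma part_residue k (k0 : 0 < k) n i : part (residue k0 (n := n)) i = residue_part n k i.
Proof. by apply/setP => x; rewrite !inE. Qed.

Lemma turan_crossing k (k0 : 0 < k) n : turan k.+1 n 3 = crossing (residue k0 (n := n)).
Proof.
apply/setP => e; rewrite !inE /=; congr (_ && _); apply/forallP/forall_inP => [H x xe|H i].
  apply/forall_inP => y ye; apply/implyP => xy; apply: contraNneq xy => E.
  apply/eqP; apply: (card_le1_eqP (H (residue k0 x)) y x); rewrite -part_residue !inE ?xe ?ye //=.
  by rewrite E.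
apply/card_le1_eqP => x y; rewrite -part_residue !inE => /andP[xe /eqP Ex] /andP[ye /eqP Ey].
apply/eqP; apply: contraT => xy; have /forall_inP /(_ _ ye) := H _ xe.
by rewrite eq_sym xy Ex Ey eqxx.
Qed.

Lemma sum_card_part (T : finType) k (P : T -> 'I_k) : \sum_i #|part P i| = #|T|.
Proof.
rewrite -sum1_card (partition_big P xpredT) //=; apply: eq_bigr => i _.
by rewrite sum1dep_card cardsE.
Qed.

Lemma sum_affine k (a : 'I_k -> nat) m p c d :
  \sum_i (m * a i ^ p + c + d * a i) = m * (\sum_i a i ^ p) + k * c + d * \sum_i a i.
Proof. by rewrite !big_split /= -!big_distrr sum_nat_const card_ord. Qed.

Lemma leq_divMn n k : k * (n %/ k) <= n.
Proof. by rewrite mulnC leq_divM. Qed.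

(** Summing [chord_bound] over the parts replaces the cubic by an affine function of the sizes,
    whose sum depends on [#|T|] only; by [chord_eq] the balanced partition attains the bound. *)
Lemma crossing_le_turan k (T : finType) (P : T -> 'I_k) : 2 < k -> 2 < #|T| ->
  (forall i, 2 * #|part P i| <= #|T|) -> #|crossing P| <= turan_number k.+1 #|T| 3.
Proof.
move=> k2 T2 half; have k0 : 0 < k by lia.
pose n := #|T|; pose q := n %/ k; pose Q := residue k0 (n := n).
rewrite /turan_number (turan_crossing k0) -/n -/Q.
rewrite -(leq_pmul2l (ltn0Sn 5)) -!ordered_crossingE.
have := ordered_crossing_parts P; have := ordered_crossing_parts Q; rewrite card_ord -/n.
have lo := leq_sum (index_enum 'I_k) (P := xpredT)
  (fun i _ => chord_bound k2 (leq_divMn n k) T2 (half i)).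
have eqQ : \sum_i (2 * #|part Q i| ^ 3 + (3 * n * q ^ 2 + q * (6 * q ^ 2 + 6 * q + 2)) +
      3 * n * (2 * q + 1) * #|part Q i|) =
    \sum_i (3 * n * #|part Q i| ^ 2 + (2 * q ^ 3 + 3 * n * (2 * q + 1) * q) +
      (6 * q ^ 2 + 6 * q + 2) * #|part Q i|).
  by apply: eq_bigr => i _; rewrite /Q part_residue card_residue_part //; apply: chord_eq.
rewrite !sum_affine !sum_card_part card_ord -/n in lo eqQ.
rewrite -/q in lo; move: (\sum_i #|part P i| ^ 3) (\sum_i #|part P i| ^ 2) lo => s3 s2.
move: (\sum_i #|part Q i| ^ 3) (\sum_i #|part Q i| ^ 2) eqQ => r3 r2.
move: (ordered_crossing P) (ordered_crossing Q) => x y.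
by clear half Q P; clearbody q; clearbody n; lia.
Qed.

(** Admitting [r = k] gives formulas for [n] and [n + 1] with the same [q]. *)
Lemma turan_formula k n q r : 0 < k -> r <= k -> n = k * q + r ->
  6 * turan_number k.+1 n 3 + 3 * n * (k * q ^ 2 + r * (2 * q + 1)) =
  n ^ 3 + 2 * (k * q ^ 3 + r * (3 * q ^ 2 + 3 * q + 1)).
Proof.
move=> k0; pose Q := residue k0 (n := n).
have main q1 r1 : r1 < k -> n = k * q1 + r1 ->
    6 * turan_number k.+1 n 3 + 3 * n * (k * q1 ^ 2 + r1 * (2 * q1 + 1)) =
    n ^ 3 + 2 * (k * q1 ^ 3 + r1 * (3 * q1 ^ 2 + 3 * q1 + 1)).
  move=> rk nE; have := ordered_crossing_parts Q.
  rewrite ordered_crossingE /turan_number (turan_crossing k0) -/Q card_ord.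
  have cQ i : #|part Q i| = q1 + (i < r1).
    rewrite /Q part_residue card_residue_part // {1 2}nE mulnC divnMDl //.
    by rewrite modnMDl modn_small // divn_small // addn0.
  have S : \sum_(i < k) (i < r1 : nat) = r1.
    rewrite -(big_mkord xpredT (fun i => (i < r1 : nat))) (big_cat_nat (n := r1)) //=; last exact: ltnW.
    rewrite big_nat (eq_bigr (fun=> 1)) => [|i /andP[_ ->] //].
    rewrite -big_nat sum_nat_const_nat subn0 muln1 big_nat big1 ?addn0 // => i /andP[ri _].
    by rewrite ltnNge ri.
  have -> : \sum_i #|part Q i| ^ 2 = k * q1 ^ 2 + r1 * (2 * q1 + 1).
    rewrite (eq_bigr (fun i : 'I_k => q1 ^ 2 + (i < r1) * (2 * q1 + 1))) => [|i _].
      by rewrite big_split /= sum_nat_const card_ord -big_distrl /= S.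
    by rewrite cQ; case: (i < r1); lia.
  have -> : \sum_i #|part Q i| ^ 3 = k * q1 ^ 3 + r1 * (3 * q1 ^ 2 + 3 * q1 + 1).
    rewrite (eq_bigr (fun i : 'I_k => q1 ^ 3 + (i < r1) * (3 * q1 ^ 2 + 3 * q1 + 1))) => [|i _].
      by rewrite big_split /= sum_nat_const card_ord -big_distrl /= S.
    by rewrite cQ; case: (i < r1); lia.
  by [].
rewrite leq_eqVlt => /orP[/eqP->|]; last exact: main.
move=> nE; have := main q.+1 0 k0 (_ : n = k * q.+1 + 0); rewrite nE => /(_ ltac:(lia)).
rewrite !expnS !expn0; lia.
Qed.

(** The increment is the degree of a vertex added to a smallest part: the number of pairs crossing
    the [j + 1] other parts, of which [r] have size [q + 1] and the rest size [q]. *)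
Lemma turan_step j n q r : r < j.+2 -> n = j.+2 * q + r ->
  2 * turan_number j.+3 n.+1 3 + r =
  2 * turan_number j.+3 n 3 + (j.+1 * j * q ^ 2 + 2 * j * q * r + r ^ 2).
Proof.
move=> rk nE; have := turan_formula (ltn0Sn j.+1) (ltnW rk) nE.
have := @turan_formula j.+2 n.+1 q r.+1 (ltn0Sn _) rk; rewrite nE addnS => /(_ erefl).
move: (turan_number _ _ _) (turan_number _ _ _) => t' t.
rewrite !expnS !expn0; clear; lia.
Qed.

(** Leading term of the increment with an error linear in [n]; this becomes the degree bound at
    every vertex. *)
Lemma turan_step_lower j n :
  j.+1 * j * n.+1 ^ 2 + j.+2 ^ 2 * (2 * turan_number j.+3 n 3) <=
  j.+2 ^ 2 * (2 * turan_number j.+3 n.+1 3) + 2 * j.+2 ^ 3 * n.+1.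
Proof.
have rk : n %% j.+2 < j.+2 by rewrite ltn_mod.
have nE : n = j.+2 * (n %/ j.+2) + n %% j.+2 by rewrite mulnC -divn_eq.
have := turan_step rk nE; move: (n %/ _) (n %% _) rk nE => q r rk nE.
move: (turan_number _ n.+1 _) (turan_number _ n _) => t' t E.
have lo : j.+2 ^ 2 * (2 * t + j.+1 * j * q ^ 2) <= j.+2 ^ 2 * (2 * t').
  rewrite leq_pmul2l ?expn_gt0 //.
  have : r <= r ^ 2 by rewrite -mulnn; case: (r) => // r'; rewrite leq_pmulr.
  by move: E; move: (j.+1 * j * q ^ 2) (2 * j * q * r) (r ^ 2) => X Y Z; clear; lia.
apply: leq_trans (leq_add lo (leqnn _)).
rewrite mulnDr addnAC -addnA [X in _ <= X]addnC leq_add2r.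
have n2 : n.+1 <= j.+2 * (q + 1) by lia.
have le2 : n.+1 ^ 2 <= (j.+2 * q) ^ 2 + 2 * j.+2 * n.+1.
  have mN : j.+2 * q <= n.+1 by lia.
  move: mN n2; rewrite mulnDr muln1 -!mulnn; move: (j.+2 * q) n.+1 => m N mN n2.
  have := leq_mul n2 (leqnn N); have := leq_mul (leqnn m) n2.
  by have := leq_mul mN (leqnn j.+2); clear; lia.
apply: leq_trans (leq_mul (leqnn _) le2) _.
rewrite mulnDr [X in _ <= X]addnC leq_add //.
  by rewrite leq_eqVlt expnMn; apply/orP; left; apply/eqP; ring.
have kk : j.+1 * j <= j.+2 * j.+2 by apply: leq_mul; lia.
apply: leq_trans (leq_mul kk (leqnn _)) _.
by rewrite leq_eqVlt; apply/orP; left; apply/eqP; ring.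
Qed.

(** * The partition of a rainbow-free coloring *)

(** [d] is the size of a heavy neighborhood, [E] the sum of the degrees inside it, [lam] the light
    weight. [E] is at least nearly [(j + 1) j n^2 / k^2], with [k = j + 2]; were [d] below
    [(1 - 1/M) (1 - 1/k) n], the density would reach [1 - 1/(j + 1) + 1/(4 M)], as [erdos_stone]
    asks. *)
Lemma dense_nbr_arith j m M C E d lam n : 0 < j -> M = m.+1 ->
  j.+1 * j * n ^ 2 <= j.+2 ^ 2 * (2 * C * n + (lam + E)) + 2 * j.+2 ^ 3 * n ->
  2 * M * j.+2 ^ 2 * lam <= n ^ 2 ->
  2 * M * (2 * j.+2 ^ 2 * C + 2 * j.+2 ^ 3) <= n ->
  n ^ 2 <= M * j.+2 ^ 2 * E /\
  (j.+2 * M * d < j.+1 * m * n -> (j * (4 * M) + j.+1) * d ^ 2 <= j.+1 * (4 * M) * E).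
Proof.
move=> j0 Mm h1 h2 h3.
have h4 : 2 * M * (2 * j.+2 ^ 2 * C + 2 * j.+2 ^ 3) * n <= n ^ 2 by rewrite -mulnn leq_mul2r h3 orbT.
have h5 : M * (j.+1 * j) * n ^ 2 <= M * j.+2 ^ 2 * E + n ^ 2.
  have := leq_mul (leqnn (2 * M)) h1; move: h2 h4.
  move: (j.+2 ^ 2) (j.+2 ^ 3) (n ^ 2) => a b X; clear; lia.
have jj : 2 <= j.+1 * j by rewrite -[2]muln1 leq_mul.
have M0 : 0 < M by rewrite Mm.
have h6 : n ^ 2 <= M * j.+2 ^ 2 * E.
  have := leq_mul (leq_mul M0 jj) (leqnn (n ^ 2)); have := leq_mul (leq_mul (leqnn M) jj) (leqnn (n ^ 2)).
  move: h5; move: (n ^ 2) (M * j.+2 ^ 2 * E) (M * _) => X e b; clear; lia.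
split=> // h7.
have h8 : j.+2 ^ 2 * M * d ^ 2 <= j.+1 ^ 2 * m * n ^ 2.
  rewrite -(leq_pmul2r M0); apply: leq_trans (_ : (j.+1 * m * n) ^ 2 <= _).
    apply: leq_trans (_ : (j.+2 * M * d) ^ 2 <= _); last by rewrite leq_sqr ltnW.
    by rewrite leq_eqVlt; apply/orP; left; apply/eqP; ring.
  rewrite (_ : (j.+1 * m * n) ^ 2 = j.+1 ^ 2 * m * n ^ 2 * m); last by ring.
  by rewrite leq_mul2l Mm leqnSn orbT.
have kM0 : 0 < j.+2 ^ 2 * M by rewrite muln_gt0 expn_gt0 M0.
rewrite -(leq_pmul2l kM0).
apply: leq_trans (_ : (j * (4 * M) + j.+1) * (j.+1 ^ 2 * m * n ^ 2) <= _).
  by rewrite mulnCA leq_mul2l h8 orbT.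
apply: leq_trans (_ : j.+1 * (4 * M) * (M * j.+2 ^ 2 * E) <= _); last first.
  by rewrite leq_eqVlt; apply/orP; left; apply/eqP; ring.
have h9 : (j * (4 * M) + j.+1) * (j.+1 * m) + 4 * M <= 4 * M * (M * (j.+1 * j)).
  have := leq_mul (leqnn M) jj; have := leq_mul (leqnn (j.+1 * M)) j0.
  by rewrite Mm; clear; nia.
have := leq_mul (leqnn (j.+1 * n ^ 2)) h9; have := leq_mul (leqnn (4 * M * j.+1)) h5.
rewrite (_ : j.+1 ^ 2 = j.+1 * j.+1); last by rewrite mulnn.
move: (n ^ 2) (M * j.+2 ^ 2 * E) => X Y; clear; lia.
Qed.

(** The link sum of [x] is at least about [(j + 1) j n^2 / k^2] and, up to small terms, at most
    [D j a], where [D] counts the neighbors of [x] in the other classes and [a], about [n / k],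
    bounds the classes. Hence [D] is nearly [(j + 1) a] and few vertices are missed. *)
Lemma extension_arith j M C X D a n b miss : 0 < n ->
  j.+1 * j * n ^ 2 <= j.+2 ^ 2 * (2 * C * n + (X * n + D * (X + 1 + j * a))) + 2 * j.+2 ^ 3 * n ->
  M * X <= b * n -> M * j.+2 * a <= (M + 2) * n -> D <= n ->
  M * (j.+2 ^ 2 * (2 * C + 1) + 2 * j.+2 ^ 3) <= n -> miss + D <= j.+1 * a ->
  j * j.+2 * M * miss <= (2 * j * j.+1 + 2 * b * j.+2 ^ 2 + 1 + 2 * j.+2 * j) * n.
Proof.
move=> n0 h1 h2 h3 h4 h5 h6.
have h7 : M * (j.+1 * j) * n <= (2 * b * j.+2 ^ 2 + 1) * n + j.+2 * j * (M + 2) * D.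
  rewrite -(leq_pmul2r n0).
  have a1 := leq_mul (leqnn M) h1.
  have a2 := leq_mul (leqnn (j.+2 ^ 2)) (leq_mul h2 (leqnn n)).
  have a3 := leq_mul (leqnn (j.+2 ^ 2)) (leq_mul h2 h4).
  have a4 := leq_mul (leqnn (j.+2 ^ 2 * M)) (leq_mul h4 (leqnn 1)).
  have a5 := leq_mul (leqnn (j.+2 * j * D)) h3.
  have a6 := leq_mul h5 (leqnn n).
  rewrite -!mulnn in a1 a2 a3 a4 a5 a6 *; move: (j.+2 ^ 3) a1 a2 a3 a4 a5 a6 => K; clear; lia.
have b1 := leq_mul (leqnn (M * j.+2 * j)) h6; have b2 := leq_mul (leqnn (j.+1 * j)) h3.
have b3 := leq_mul (leqnn (j.+2 * j * 2)) h4.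
rewrite -!mulnn in h7 *; move: h7 b1 b2 b3; clear; lia.
Qed.

(** * Links and heavy neighborhoods *)

Section Structure.
Variables (j : nat) (V T : finType) (F : {set {set V}}) (c : {set T} -> nat).
Variable (G : {set {set T}}).
Hypothesis F2 : uniform 2 F.
Hypothesis j0 : 0 < j.
Hypothesis crit : doubly_edge_critical j.+3 F.
Hypothesis G3 : G \subset triples T.
Hypothesis cG : {in G &, injective c}.
Hypothesis norb : ~ has_rainbow (triples T) c (expansion 3 F).

Local Notation C := (heavy_bound F).
Local Notation H := (heavy G C).
Local Notation N := (nbr H).
Local Notation k := j.+2.
Local Notation n := #|T|.

Let symH : symmetric H := @heavy_sym T G C.

Definition link x y := [set z | z |: [set x; y] \in G].

Lemma link_swap x : symmetric (fun y z => z \in link x y).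
Proof.
move=> y z; rewrite !inE; congr (_ \in G); apply/setP => u.
by rewrite !inE; case: (u == x); case: (u == y); case: (u == z).
Qed.

Lemma link_rot x y z : (z \in link x y) = (x \in link y z).
Proof.
rewrite !inE; congr (_ \in G); apply/setP => u.
by rewrite !inE; case: (u == x); case: (u == y); case: (u == z).
Qed.

Lemma nbr_link x y : nbr (fun y z => z \in link x y) y = link x y.
Proof. by apply/setP => z; rewrite !inE. Qed.

Lemma card_link_light x y : y \notin N x -> #|link x y| <= C.
Proof. by rewrite inE -leqNgt. Qed.

(** A vertex outside the heavy neighborhood of [x] occurs in at most [C] pairs of the link on either
    side. *)
Lemma link_sum_le x :
  \sum_y #|link x y| <= 2 * C * n + \sum_(y in N x) #|link x y :&: N x|.
Proof.
have light : \sum_(y | y \notin N x) #|link x y| <= C * n.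
  apply: leq_trans (_ : \sum_(y in ~: N x) C <= _).
    rewrite (eq_bigl (mem (~: N x))) => [|y]; last by rewrite !inE.
    by apply: leq_sum => y yN; apply: card_link_light; rewrite -in_setC.
  by rewrite sum_nat_const mulnC leq_mul2l max_card orbT.
have swap : \sum_(y in N x) #|link x y :&: ~: N x| <= C * n.
  have := sum_card_nbr (N x) (~: N x) (@link_swap x).
  under eq_bigr do rewrite nbr_link; under [X in _ = X -> _]eq_bigr do rewrite nbr_link.
  move=> ->; apply: leq_trans light; rewrite (eq_bigl (fun y => y \notin N x)) => [|y]; last by rewrite !inE.
  by apply: leq_sum => y _; apply: subset_leq_card (subsetIl _ _).
have E m : 2 * m * n = m * n + m * n by lia.
rewrite E (bigID (mem (N x))) /= addnC -addnA leq_add //.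
rewrite (eq_bigr (fun y => #|link x y :&: N x| + #|link x y :&: ~: N x|)); last first.
  by move=> y _; rewrite -setDE addnC [RHS]addnC cardsID.
by rewrite big_split /= addnC leq_add.
Qed.

(** The number of ordered pairs in the link of [x] that are not heavy. *)
Definition light_weight x := \sum_y #|link x y :\: N y|.

(** A pair that is not heavy lies in at most [C] links. *)
Lemma sum_light_weight : \sum_x light_weight x <= C * n ^ 2.
Proof.
rewrite /light_weight exchange_big /=; apply: leq_trans (_ : \sum_(y : T) C * n <= _).
  apply: leq_sum => y _.
  have -> : \sum_x #|link x y :\: N y| = \sum_(z in ~: N y) #|link y z|.
    rewrite (eq_bigr (fun x => \sum_(z in ~: N y) (z \in link x y))); last first.
      move=> x _; rewrite -sum1_card big_mkcond [RHS]big_mkcond /=.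
      by apply: eq_bigr => z _; rewrite in_setD in_setC; case: (_ \notin _); case: (_ \in _).
    rewrite exchange_big /=; apply: eq_bigr => z _.
    by rewrite -sum1_card [RHS]big_mkcond /=; apply: eq_bigr => x _; rewrite link_rot; case: (_ \in _).
  apply: leq_trans (_ : \sum_(z in ~: N y) C <= _).
    by apply: leq_sum => z zN; apply: card_link_light; rewrite -in_setC.
  by rewrite sum_nat_const mulnC leq_mul2l max_card orbT.
by rewrite sum_nat_const -mulnn mulnCA leqnn.
Qed.

(** Markov's inequality for the total light weight; the bound does not grow with [n]. *)
Lemma card_bad M : 0 < n -> #|[set x | n ^ 2 < M * light_weight x]| <= M * C.
Proof.
move=> n0; set B := [set x | _]; have n2 : 0 < n ^ 2 by rewrite expn_gt0 n0.
rewrite -(leq_pmul2r n2) -mulnA; apply: leq_trans (leq_mul (leqnn M) sum_light_weight).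
rewrite big_distrr /= -sum_nat_const [X in _ <= X](bigID (mem B)) /=.
apply: leq_trans (leq_addr _ _); apply: leq_sum => x; rewrite inE; exact: ltnW.
Qed.

Lemma link_in_nbr x :
  \sum_(y in N x) #|link x y :&: N x| <= light_weight x + \sum_(y in N x) #|N y :&: N x|.
Proof.
rewrite /light_weight (bigID (mem (N x)) xpredT) /= addnAC.
apply: leq_trans (leq_addr _ _); rewrite -big_split /=; apply: leq_sum => y _.
rewrite -(cardsID (N y) (_ :&: _)) addnC; apply: leq_add; apply: subset_leq_card.
  by apply/subsetP => z; rewrite !inE => /andP[-> /andP[-> _]].
by apply/subsetP => z; rewrite !inE => /andP[/andP[_ ->] ->].
Qed.

Hypothesis deg : forall x, j.+1 * j * n ^ 2 <= k ^ 2 * (\sum_y #|link x y|) + 2 * k ^ 3 * n.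

Lemma no_joined_blowup x (A : 'I_k -> {set T}) t : #|V| < t ->
  blowup H t A -> (forall i, A i \subset N x) -> False.
Proof.
move=> Vt [cA adjA] AN; apply: (no_join F2 crit G3 cG norb (m := 0) AN) => [i i' ii' y yA|i].
  rewrite leqn0 cards_eq0 setD_eq0; apply/subsetP => z zA.
  by rewrite inE symH; apply: adjA zA yA.
by rewrite muln0 cA.
Qed.

(** Otherwise the heavy neighborhood of [x] is dense enough to contain a blowup, which is then
    joined to [x]. *)
Lemma high_degree m n0 x :
  (forall S : {set T}, n0 <= #|S| -> (j * (4 * m.+1) + j.+1) * #|S| ^ 2 <=
      j.+1 * (4 * m.+1) * \sum_(y in S) #|N y :&: S| ->
    exists2 A : 'I_k -> {set T}, (forall i, A i \subset S) & blowup H #|V|.+1 A) ->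
  0 < n -> 2 * m.+1 * (2 * k ^ 2 * C + 2 * k ^ 3) <= n -> n0 * (m.+1 * k ^ 2) <= n ->
  2 * m.+1 * k ^ 2 * light_weight x <= n ^ 2 ->
  j.+1 * m * n <= k * m.+1 * #|N x|.
Proof.
move=> ES n_gt0 n_big nn0 xlight; rewrite leqNgt; apply/negP => small.
have lo : j.+1 * j * n ^ 2 <= k ^ 2 * (2 * C * n + (light_weight x +
    \sum_(y in N x) #|N y :&: N x|)) + 2 * k ^ 3 * n.
  apply: leq_trans (deg x) _; rewrite leq_add2r leq_mul2l; apply/orP; right.
  by apply: leq_trans (link_sum_le x) _; rewrite leq_add2l link_in_nbr.
have [h1 h2] := dense_nbr_arith #|N x| j0 (erefl m.+1) lo xlight n_big.
have [|A AN Ab] := ES (N x) _ (h2 small).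
  have M0 : 0 < m.+1 * k ^ 2 by rewrite muln_gt0 expn_gt0.
  (* The quadratic lower bound on the degree sum forces the neighborhood to have at least [n0]
     vertices. *)
  have e1 : \sum_(y in N x) #|N y :&: N x| <= n * #|N x|.
    apply: leq_trans (_ : \sum_(y in N x) n <= _); last by rewrite sum_nat_const mulnC.
    by apply: leq_sum => y _; apply: max_card.
  rewrite -(leq_pmul2r M0) (leq_trans nn0) // -(leq_pmul2l n_gt0) mulnn.
  apply: leq_trans h1 _; rewrite mulnA [X in _ <= X]mulnC leq_mul2l e1 orbT //.
exact: no_joined_blowup (leqnn _) Ab AN.
Qed.

(** * Classes of vertices around a complete multipartite graph *)

Section Blowup.
Variables (U : 'I_k -> {set T}) (s q : nat) (Bad : {set T}).
Hypothesis Ub : blowup H s U.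
Local Notation t0 := #|V|.+1.
Hypothesis tqs : t0 + q <= s.

Lemma few_nbrs x : exists i, #|N x :&: U i| < t0.
Proof.
apply/existsP; apply: contraT => /existsPn all; exfalso.
have [_ adjU] := Ub.
apply: (no_join F2 crit G3 cG norb (x := x) (R := fun i => N x :&: U i) (m := 0)).
- by move=> i; apply: subsetIl.
- move=> i i' ii' y /setIP[_ yU]; rewrite leqn0 cards_eq0 setD_eq0.
  by apply/subsetP => z /setIP[_ zU]; rewrite inE symH; apply: adjU zU yU.
by move=> i; rewrite muln0 add0n ltnNge -ltnS -ltnNge ltnS leqNgt all.
Qed.

(** Vertices that the blowup cannot tell from members of [U i], within the tolerances [t0] and
    [q]. *)
Definition class i : {set T} := [set x | [&& x \notin Bad, #|N x :&: U i| < t0 &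
  [forall i', (i' != i) ==> (#|U i' :\: N x| <= q)]]].

Lemma classP i x : reflect [/\ x \notin Bad, #|N x :&: U i| < t0 &
  forall i', i' != i -> #|U i' :\: N x| <= q] (x \in class i).
Proof.
rewrite inE; apply: (iffP and3P) => -[xB xi H1]; split=> //.
  by move=> i' ii'; have /forallP /(_ i') /implyP -> := H1.
by apply/forallP => i'; apply/implyP/H1.
Qed.

Lemma card_part_split i x : #|N x :&: U i| + #|U i :\: N x| = s.
Proof. by have [cU _] := Ub; rewrite setIC cardsID cU. Qed.

Lemma class_disjoint i i' x : x \in class i -> x \in class i' -> i = i'.
Proof.
move=> /classP[_ xi _] /classP[_ _ xi']; apply/eqP; apply: contraT => /xi'.
have := card_part_split i x; move: xi tqs; lia.
Qed.

Lemma sum_nbrs_blowup x : \sum_i #|N x :&: U i| <= t0 + j.+1 * s.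
Proof.
have [i ti] := few_nbrs x; rewrite (bigD1 i) //= leq_add //; first exact: ltnW.
apply: leq_trans (_ : \sum_(i' | i' != i) s <= _).
  by apply: leq_sum => i' _; have := card_part_split i' x; lia.
by rewrite sum_nat_const cardC1 card_ord.
Qed.

Lemma sum_nbrs_unclassified x : x \notin Bad -> (forall i, x \notin class i) ->
  \sum_i #|N x :&: U i| + q <= t0 + j.+1 * s.
Proof.
move=> xB xn; have [i ti] := few_nbrs x.
have /existsP [i' /andP[ii' qi']] : [exists i', (i' != i) && (q < #|U i' :\: N x|)].
  apply: contraR (xn i) => /existsPn /= no; apply/classP; split=> // i' ii'.
  by have := no i'; rewrite ii' /= -leqNgt.
rewrite (bigD1 i) //= (bigD1 i') //= -!addnA leq_add //; first exact: ltnW.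
have -> : j.+1 * s = s + \sum_(i0 | (i0 != i) && (i0 != i')) s.
  have := sum_nat_const (mem [pred i0 | i0 != i]) s.
  rewrite cardC1 card_ord => <-.
  by rewrite (bigD1 i') //=.
rewrite addnCA addnC leq_add //; first by have := card_part_split i' x; lia.
by apply: leq_sum => i0 _; have := card_part_split i0 x; lia.
Qed.

Definition classified := \bigcup_i class i.

(** Double counting of heavy pairs between the blowup and all vertices: a vertex has at most
    [t0 + (j + 1) s] neighbors in the blowup, an unclassified one outside [Bad] at most [q] less,
    while degrees of vertices of the blowup are at least nearly [(1 - 1/k) n]. *)
Lemma card_unclassified m :
  (forall i u, u \in U i -> j.+1 * m * n <= k * m.+1 * #|N u|) ->
  m.+1 * (q * #|~: (classified :|: Bad)|) <= (m.+1 * t0 + j.+1 * s) * n.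
Proof.
move=> degU; set X := ~: _.
have up : \sum_x \sum_i #|N x :&: U i| + q * #|X| <= (t0 + j.+1 * s) * n.
  rewrite mulnC -(sum_nat_const (mem X)) [X in _ + X]big_mkcond -big_split /=.
  rewrite mulnC -sum_nat_const; apply: leq_sum => x _.
  case: ifP => [xX|_]; last by rewrite addn0 sum_nbrs_blowup.
  move: xX; rewrite inE in_setU negb_or => /andP[xc xB].
  apply: sum_nbrs_unclassified => // i; apply: contra xc => xi.
  by apply/bigcupP; exists i.
have lo : s * (j.+1 * m * n) <= m.+1 * \sum_x \sum_i #|N x :&: U i|.
  have [cU _] := Ub; rewrite exchange_big /=.
  rewrite -(leq_pmul2l (ltn0Sn j.+1)) [X in _ <= X]mulnA big_distrr.
  apply: leq_trans (_ : \sum_(i < k) s * (j.+1 * m * n) <= _).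
    by rewrite sum_nat_const card_ord.
  apply: leq_sum => i _; have := sum_card_nbr [set: T] (U i) symH.
  under eq_bigl do rewrite inE; under [X in _ = X -> _]eq_bigr do rewrite setIT.
  move=> ->; rewrite big_distrr -(cU i) -sum_nat_const.
  by apply: leq_sum => u; apply: degU.
have := leq_mul (leqnn m.+1) up; move: lo.
move: (\sum_x _) => S; clear; lia.
Qed.

(** Such neighbors, together with the vertices of the other parts adjacent to [x] and to all of
    them, would form a [k]-partite graph joined to [x]; each part loses at most [(t0 + 1) q]
    vertices. *)
Lemma class_degree i x : t0.+1 * q + t0 <= s -> x \in class i ->
  #|N x :&: class i| < t0.
Proof.
move=> tq xi; rewrite ltnNge; apply/negP => big; have [cU adjU] := Ub.
have [Y YN cY] := exists_subset_card big.
have YP y : y \in Y -> H x y /\ y \in class i.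
  by move=> /(subsetP YN)/setIP[]; rewrite inE.
pose Z i' := U i' :\: N x :|: \bigcup_(y in Y) (U i' :\: N y).
have cZ i' : i' != i -> #|Z i'| <= t0.+1 * q.
  move=> ii'; rewrite mulSn; apply: leq_trans (leq_card_setU _ _) _; apply: leq_add.
    by have /classP[_ _] := xi; apply.
  apply: leq_trans (card_bigcup_le _ _) _; rewrite -cY -sum_nat_const.
  by apply: leq_sum => y /YP[_ /classP[_ _]]; apply.
have ZP i' z : z \in U i' -> z \notin Z i' -> H x z /\ forall y, y \in Y -> H y z.
  move=> zU; rewrite !inE zU andbT negb_or negbK => /andP[xz zY]; split=> // y yY.
  by apply: contraR zY => nyz; apply/bigcupP; exists y; rewrite // !inE nyz.
apply: (no_join F2 crit G3 cG norb (x := x) (m := 0)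
  (R := fun i' => if i' == i then Y else U i' :\: Z i')) => [i'|i1 i2 i12 y|i'].
- apply/subsetP => z; rewrite inE; case: eqP => _; first by case/YP.
  by case/setDP => zU /ZP[].
- rewrite leqn0 cards_eq0 setD_eq0 => yR; apply/subsetP => z; move: yR.
  rewrite inE; have [E1|n1] := eqVneq i1 i; have [E2|n2] := eqVneq i2 i.
  + by rewrite E1 E2 eqxx in i12.
  + by case/setDP => yU /(ZP _ _ yU)[_ yY] zY; rewrite symH yY.
  + by move=> yY /setDP[zU /(ZP _ _ zU)[_]]; apply.
  by case/setDP=> yU _ /setDP[zU _]; rewrite symH; apply: adjU zU yU.
rewrite muln0 add0n; have [_|ii'] := eqVneq i' i; first by rewrite cY.
have := cZ i' ii'; have := subset_leq_card (subsetIr (U i') (Z i')).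
rewrite cardsD cU; move: tq; clear; lia.
Qed.

Section Sizes.
Variables (m M3 : nat).
Hypothesis tq : t0.+1 * q + t0 <= s.
Hypothesis degN : forall x, x \notin Bad -> j.+1 * m * n <= k * m.+1 * #|N x|.
Hypothesis Mm : k * M3 <= m.+1.
Hypothesis Mn : k * t0 * M3 <= n.
Hypothesis few : M3 * #|~: classified| <= 2 * n.

Lemma nbr_lower x : x \notin Bad -> M3 * j.+1 * n <= M3 * k * #|N x| + n.
Proof.
move=> /degN dx; have h1 := leq_mul (leqnn M3) dx.
have h2 := leq_mul Mm (leqnn n).
rewrite -(leq_pmul2l (ltn0Sn m)); move: h1 h2; move: #|N x| n => d v; clear; lia.
Qed.

Lemma class_union_nbr i x (A : {set T}) : x \in class i -> [disjoint A & class i] ->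
  [disjoint A & N x] -> #|A| + #|N x| + #|class i| <= n + t0.
Proof.
move=> xi dA dN; have h1 := class_degree tq xi.
have h2 := subset_leq_card (subsetT (A :|: (N x :|: class i))).
have EA : #|A :|: (N x :|: class i)| = #|A| + #|N x :|: class i|.
  apply/eqP; rewrite (leq_card_setU A (N x :|: class i)).
  by rewrite -setI_eq0 setIUr setU_eq0 !setI_eq0 dN dA.
rewrite EA cardsU cardsT in h2; have := subset_leq_card (subsetIl (N x) (class i)).
move: h1 h2; clear; lia.
Qed.

(** A class almost avoids the neighborhood of any of its members, which has at least nearly
    [(1 - 1/k) n] vertices. *)
Lemma class_le i : M3 * k * #|class i| <= (M3 + 2) * n.
Proof.
have [->|[x xi]] := set_0Vmem (class i); first by rewrite cards0 muln0.
have := class_union_nbr (A := set0) xi; rewrite -!setI_eq0 !set0I eqxx cards0 => /(_ isT isT).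
have /classP[xB _ _] := xi; have h1 := nbr_lower xB => h2.
have := leq_mul (leqnn (M3 * k)) h2; move: h1 Mn.
move: #|N x| #|class i| n => d w v; clear; lia.
Qed.

Lemma class_ge i : M3 * n <= M3 * k * #|class i| + 4 * k * n.
Proof.
have h1 : n <= #|class i| + \sum_(i' | i' != i) #|class i'| + #|~: classified|.
  rewrite -(cardsC classified) leq_add2r.
  by have := card_bigcup_le xpredT class; rewrite [X in _ <= X](bigD1 i).
have h2 : M3 * k * \sum_(i' | i' != i) #|class i'| <= j.+1 * ((M3 + 2) * n).
  rewrite big_distrr /=; apply: leq_trans (_ : \sum_(i' | i' != i) (M3 + 2) * n <= _).
    by apply: leq_sum => i' _; apply: class_le.
  by rewrite sum_nat_const cardC1 card_ord.
have := leq_mul (leqnn (M3 * k)) h1; have := leq_mul few (leqnn k); move: h2.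
move: (\sum_(i' | i' != i) _) #|class i| n #|~: classified| => S w v u; clear; lia.
Qed.

(** The missed vertices, the neighborhood of [x] and its class are almost disjoint, and the last two
    almost fill the vertex set. *)
Lemma class_miss i i' x : x \in class i -> i' != i -> M3 * #|class i' :\: N x| <= 5 * n.
Proof.
move=> xi ii'; have /classP[xB _ _] := xi.
have := class_union_nbr (A := class i' :\: N x) xi.
have -> : [disjoint class i' :\: N x & class i].
  rewrite disjoints_subset; apply/subsetP => y /setDP[yi' _]; rewrite inE.
  by apply: contra ii' => yi; rewrite (class_disjoint yi yi').
have -> : [disjoint class i' :\: N x & N x].
  by rewrite disjoints_subset; apply/subsetP => y /setDP[_]; rewrite in_setC.
move=> /(_ isT isT) h1; rewrite -(leq_pmul2r (ltn0Sn j.+1)).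
have := leq_mul (leqnn (M3 * k)) h1; have := nbr_lower xB; have := class_ge i; move: Mn.
move: #|N x| #|class i| n #|_ :\: _| => d w v u; clear; lia.
Qed.

End Sizes.

End Blowup.

Lemma link_uniq x y z : z \in link x y -> uniq [:: y; z; x].
Proof.
rewrite inE => /(subsetP G3); rewrite inE !cardsU1 cards1 !inE /= andbT negb_or !inE.
by rewrite (eq_sym y z) (eq_sym y x); case: (z == x); case: (z == y); case: (x == y).
Qed.

(** * Placing the remaining vertices *)

Section Extension.
Variables (W : 'I_k -> {set T}) (m : nat).
Hypothesis Wtyp : forall i x, x \in W i -> typical F G W m i x.
Hypothesis Wbig : forall i, #|V| * m + 4 * m + #|V| + #|F| + 20 < #|W i|.

Lemma few_nbrs_class x : exists i, #|N x :&: W i| <= #|V| * m + #|V|.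
Proof.
apply/existsP; apply: contraT => /existsPn all; exfalso.
apply: (no_join F2 crit G3 cG norb (x := x) (R := fun i => N x :&: W i) (m := m)).
- by move=> i; apply: subsetIl.
- move=> i i' ii' y /setIP[_ yW]; apply: leq_trans (Wtyp yW ii').
  by apply/subset_leq_card/setSD/subsetIr.
by move=> i; rewrite ltnNge all.
Qed.

(** By [same_part_same_color], triples with two vertices in [W i] have a common color, and [G] has
    one triple per color. *)
Lemma card_link_class x y i : y \in W i -> #|link x y :&: W i| <= 1.
Proof.
move=> yW; apply/card_le1_eqP => z z' /setIP[zl zW] /setIP[zl' zW'].
have E : z |: [set x; y] = z' |: [set x; y].
  apply: cG; [by rewrite inE in zl|by rewrite inE in zl'|].
  have S (u : T) : u |: [set x; y] = [set y; u; x].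
    by apply/setP => v; rewrite !inE; case: (v == x); case: (v == y); case: (v == u).
  rewrite !S; exact: (same_part_same_color F2 crit G3 cG norb Wtyp Wbig
    (link_uniq zl) (link_uniq zl') (Wtyp yW) (Wtyp zW) (Wtyp yW) (Wtyp zW')).
have := link_uniq zl; rewrite /= !inE negb_or andbT => /andP[/andP[yz _] zx].
have : z \in z' |: [set x; y] by rewrite -E setU11.
by rewrite !inE (negPf zx) eq_sym (eq_sym z y) (negPf yz) !orbF => /eqP.
Qed.

Variables (a : nat).
Hypothesis Wle : forall i, #|W i| <= a.
Local Notation X := (~: \bigcup_i W i).

(** Used for a class [i] with few neighbors of [x]. A neighbor [y] in another class [i1] has at most
    one link vertex in [W i1], so its link inside the neighborhood is covered by [j] classes and a
    small rest. *)
Lemma link_sum_class x i :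
  \sum_(y in N x) #|link x y :&: N x| <=
  (#|X| + #|N x :&: W i|) * n +
  #|N x :&: \bigcup_(i' | i' != i) W i'| * (#|X| + #|N x :&: W i| + 1 + j * a).
Proof.
set Y := N x :&: \bigcup_(i' | _) _; set e := #|X| + _.
rewrite (bigID (mem Y)) /= addnC; apply: leq_add.
  apply: leq_trans (_ : \sum_(y in X :|: N x :&: W i) n <= _); last first.
    by rewrite sum_nat_const leq_mul2r leq_card_setU orbT.
  rewrite big_mkcond [X in _ <= X]big_mkcond /=; apply: leq_sum => y _.
  case: ifP => // /andP[yN yY]; rewrite ifT ?max_card //.
  move: yY; rewrite !in_setU in_setC !in_setI yN /= => yY.
  have [yi|yi] := boolP (y \in W i); first by rewrite orbT.
  rewrite orbF; apply: contra yY => /bigcupP[i' _ yi'].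
  apply/bigcupP; exists i' => //.
  by apply: contraNneq yi => <-.
apply: leq_trans (_ : \sum_(y in Y) (e + 1 + j * a) <= _); last by rewrite sum_nat_const.
rewrite (eq_bigl (mem Y)) => [|y]; last by rewrite andb_idl // => /setIP[].
apply: leq_sum => y /setIP[_ /bigcupP[i1 i1i yi1]].
pose B := \bigcup_(i' | (i' != i) && (i' != i1)) W i'.
apply: leq_trans (_ : #|X :|: N x :&: W i :|: link x y :&: W i1 :|: B| <= _).
  apply: subset_leq_card; apply/subsetP => z /setIP[zl zN].
  rewrite !in_setU in_setC !in_setI zN zl /=.
  have [/bigcupP[i2 _ zi2]|] := boolP (z \in \bigcup_i' W i') => //=.
  have [<-|n2] := eqVneq i2 i; first by rewrite zi2.
  have [<-|n21] := eqVneq i2 i1; first by rewrite zi2 orbT.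
  by apply/orP; right; apply/bigcupP; exists i2; rewrite ?n2.
apply: leq_trans (leq_card_setU _ _) _; apply: leq_add.
  apply: leq_trans (leq_card_setU _ _) _; apply: leq_add; last exact: card_link_class.
  exact: leq_card_setU.
apply: leq_trans (card_bigcup_le _ _) _.
apply: leq_trans (_ : \sum_(i' | (i' != i) && (i' != i1)) a <= _); first exact: leq_sum.
rewrite sum_nat_const leq_mul2r; apply/orP; right.
have := cardsC1 i; rewrite card_ord (cardsD1 i1 [set~ i]) !inE i1i add1n => -[cj].
rewrite -[X in _ <= X]cj; apply: subset_leq_card.
by apply/subsetP => i'; rewrite !inE andbC.
Qed.

(** Serves to place the vertices outside all classes: the size of its link forces [x] to be adjacent
    to almost all of every class but one in which it has few neighbors. *)
Lemma extension M b x : 0 < n ->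
  M * (#|X| + (#|V| * m + #|V|)) <= b * n -> M * k * a <= (M + 2) * n ->
  M * (k ^ 2 * (2 * C + 1) + 2 * k ^ 3) <= n ->
  exists i, forall i', i' != i ->
    j * k * M * #|W i' :\: N x| <= (2 * j * j.+1 + 2 * b * k ^ 2 + 1 + 2 * k * j) * n.
Proof.
move=> n0 Xb Ma nbig; have [i xi] := few_nbrs_class x; exists i => i' ii'.
set Y := N x :&: \bigcup_(i' | i' != i) W i'.
apply: (extension_arith (X := #|X| + #|N x :&: W i|) (D := #|Y|) (a := a) (C := C)) => //.
- apply: leq_trans (deg x) _; rewrite leq_add2r leq_mul2l; apply/orP; right.
  by apply: leq_trans (link_sum_le x) _; rewrite leq_add2l link_sum_class.
- by apply: leq_trans Xb; rewrite leq_mul2l leq_add2l xi orbT.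
- exact: max_card.
apply: leq_trans (_ : \sum_(i' | i' != i) a <= _); last by rewrite sum_nat_const cardC1 card_ord.
apply: leq_trans (_ : #|\bigcup_(i' | i' != i) W i'| <= _); last first.
  by apply: leq_trans (card_bigcup_le _ _) _; apply: leq_sum.
rewrite -(cardsID (N x) (\bigcup_(i' | i' != i) W i')) addnC setIC leq_add2l.
by apply/subset_leq_card/setSD/bigcup_sup.
Qed.

End Extension.

End Structure.

(** [1 - 1/k] exceeds [1 - 1/(j + 1)] by [1/((j + 1) k)]; a quarter of this gap survives the removal
    of at most [B] bad vertices. *)
Lemma blowup_degree_arith j m M B d n S : 0 < j -> M = m.+1 -> 4 * j.+1 ^ 2 <= M ->
  4 * j.+1 * j.+2 * B <= n -> j.+1 * m * n <= j.+2 * M * (d + B) -> S <= n ->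
  (j * (4 * j.+1 * j.+2) + j.+1) * S <= j.+1 * (4 * j.+1 * j.+2) * d.
Proof.
move=> j0 Mm hM hB hd hS; apply: leq_trans (leq_mul (leqnn _) hS) _.
have M0 : 0 < j.+2 * M by rewrite Mm.
rewrite -(leq_pmul2l M0).
have a1 := leq_mul (leqnn (4 * j.+1 * j.+2 * j.+1)) hd.
have a2 := leq_mul (leqnn (j.+2 * M * j.+1)) hB.
have a3 := leq_mul (leqnn (j.+1 * j.+2 * n)) hM.
rewrite -mulnn in a3; rewrite Mm in a1 a2 a3 *.
move: a1 a2 a3; clear; nia.
Qed.

Lemma sum_leP a b c d e f g h i j n :
  a + b + c + d + e + f + g + h + i + j <= n ->
  [/\ a <= n, b <= n, c <= n, d <= n &
   [/\ e <= n, f <= n, g <= n, h <= n & i <= n /\ j <= n]].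
Proof. by move=> le; split; [..|split; [..|split]]; apply: leq_trans le; lia. Qed.

(** All but boundedly many vertices have large heavy degree, they contain a large blowup, its
    classes have nearly [#|T| / k] vertices, and [extension] distributes the rest. The last
    conclusion is what [crossing_le_turan] asks. *)
Lemma vertex_partition j (V : finType) (F : {set {set V}}) :
  uniform 2 F -> 0 < j -> doubly_edge_critical j.+3 F ->
  exists n1, forall (T : finType) (c : {set T} -> nat) (G : {set {set T}}),
  n1 <= #|T| -> G \subset triples T -> {in G &, injective c} ->
  ~ has_rainbow (triples T) c (expansion 3 F) ->
  (forall x, j.+1 * j * #|T| ^ 2 <=
    j.+2 ^ 2 * (\sum_y #|link G x y|) + 2 * j.+2 ^ 3 * #|T|) ->
  exists (W : 'I_j.+2 -> {set T}) (m : nat) (P : T -> 'I_j.+2),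
  [/\ forall i x, x \in W i -> typical F G W m i x,
      forall i, #|V| * m + 4 * m + #|V| + #|F| + 20 < #|W i|,
      forall x, typical F G W m (P x) x &
      forall i, 2 * #|part P i| <= #|T|].
Proof.
move=> F2 j0 crit; pose C := heavy_bound F.
have [v Ev] : exists v, v = #|V| by exists #|V|.
have [f Ef] : exists f, f = #|F| by exists #|F|.
(* [s]: a part of the blowup of size [s] keeps [v + 1] common neighbors of any [v + 2]
   vertices that miss at most [q] of its vertices each. *)
pose k := j.+2; pose M5 := 4 * k * (v + 5); pose b := 5 * v + 3.
(* [c2] is the constant of [extension]; [M3] is chosen from it so that a vertex misses at most
   [n / M5] vertices of each other class, and [m2] then puts the degrees close enough to
   [(1 - 1/k) n]. *)
pose c2 := 2 * j * j.+1 + 2 * b * k ^ 2 + 1 + 2 * k * j.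
pose M3 := (c2 + 5 + 16 * k) * M5; pose q := v.+2 * M3; pose s := v.+2 * q + v.+1.
pose m2 := k * M3 + j.+1 * s + 4 * j.+1 ^ 2.
have [n0e ES] := @erdos_stone j.+1 v.+1 (4 * m2.+1) isT isT.
have [n0d MD] := @min_degree_blowup j.+1 s (4 * j.+1 * k) isT.
pose B := 2 * m2.+1 * k ^ 2 * C.
exists (1 + 2 * m2.+1 * (2 * k ^ 2 * C + 2 * k ^ 3) + n0e * (m2.+1 * k ^ 2) + (n0d + B) +
  4 * j.+1 * k * B + M3 * B + k * v.+1 * M3 + M3 * v +
  M3 * (k ^ 2 * (2 * C + 1) + 2 * k ^ 3) + 4 * k * (v + f + 20)).
move=> T c G nbig G3 cG norb deg.
pose n := #|T|; rewrite -/n in nbig.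
have [n_gt0 nb1 nb2 nb3 [nb4 nb5 nb6 nb7 [nb8 nb9]]] : [/\ 0 < n,
  2 * m2.+1 * (2 * k ^ 2 * C + 2 * k ^ 3) <= n, n0e * (m2.+1 * k ^ 2) <= n, n0d + B <= n &
  [/\ 4 * j.+1 * k * B <= n, M3 * B <= n, k * v.+1 * M3 <= n, M3 * v <= n &
   M3 * (k ^ 2 * (2 * C + 1) + 2 * k ^ 3) <= n /\ 4 * k * (v + f + 20) <= n]].
  exact: sum_leP.
clear nbig.
have hM5 : 4 * k * (v + 5) <= M5 by [].
have M5_gt0 : 0 < M5 by rewrite /M5 /k addnS !muln_gt0.
have hM3a : c2 * M5 <= M3 by rewrite leq_mul2r -addnA leq_addr orbT.
have hM3b : 5 * M5 <= M3 by rewrite leq_mul2r -addnA addnCA leq_addr orbT.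
have hM3c : 16 * k <= M3.
  by rewrite -[X in X <= _]muln1; apply: leq_mul; rewrite // leq_addl.
have M3_gt0 : 0 < M3 by apply: leq_trans hM3c.
have [hm1 hm2 hm3] : [/\ k * M3 <= m2.+1, j.+1 * s <= m2.+1 & 4 * j.+1 ^ 2 <= m2.+1].
  by rewrite /m2; move: (k * M3) (j.+1 * s) (4 * _) => x y z; clear; split; lia.
have c2_gt0 : 0 < c2 by rewrite /c2 addnAC addn1.
have Ec2 : c2 = 2 * j * j.+1 + 2 * b * k ^ 2 + 1 + 2 * k * j by [].
clearbody M5 c2 M3 m2.
pose H := heavy G C; pose N := nbr H.
pose Bad := [set x | n ^ 2 < 2 * m2.+1 * k ^ 2 * light_weight F G x].
have cBad : #|Bad| <= B by apply: card_bad.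
have degN x : x \notin Bad -> j.+1 * m2 * n <= k * m2.+1 * #|N x|.
  rewrite inE -leqNgt => xl; apply: (high_degree F2 j0 crit G3 cG norb deg) xl => //; last exact: nb2.
  move=> S nS dS; rewrite -Ev; exact: ES (@heavy_sym T G C) (@heavy_irr T G C G3) nS dS.
have [|x xB|U US Ub] := MD T H (~: Bad) (@heavy_sym T G C) (@heavy_irr T G C G3).
- have := cardsC Bad; move: cBad nb3; rewrite -/n; clear; lia.
- rewrite inE in xB; have := degN x xB => dx.
  apply: (@blowup_degree_arith j m2 m2.+1 B _ n) => //; last exact: max_card.
  apply: leq_trans dx _; rewrite leq_mul2l; apply/orP; right.
  rewrite -(cardsID (~: Bad) (N x)) leq_add2l.
  apply: leq_trans cBad; apply: subset_leq_card; apply/subsetP => y.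
  by rewrite !inE negbK => /andP[].
have tqs : v.+1 + q <= s by rewrite /s mulSn; clear; lia.
have tq : v.+2 * q + v.+1 <= s by [].
rewrite Ev in tqs tq.
pose X := ~: classified F G U q Bad.
have degU i u : u \in U i -> j.+1 * m2 * n <= k * m2.+1 * #|N u|.
  by move=> uU; apply: degN; have := subsetP (US i) u uU; rewrite inE.
(* One share [n / M3] is for [card_unclassified], where [(j + 1) s <= m2 + 1], the other for
   [Bad]. *)
have few : M3 * #|X| <= 2 * n.
  have h1 := card_unclassified F2 j0 crit G3 cG norb Bad Ub tqs degU.
  set Y := ~: _ in h1.
  have h2 : M3 * #|Y| <= n.
    have q0 : 0 < v.+2 * m2.+1 by [].
    rewrite -(leq_pmul2l q0); rewrite -Ev /q in h1.
    have h3 := leq_mul hm2 (leqnn n); move: h1 h3; rewrite -/n.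
    move: (j.+1 * s) #|Y| (n) => a y u; clear; lia.
  have XY : #|X| <= #|Y| + #|Bad|.
    apply: leq_trans (leq_card_setU _ _); apply: subset_leq_card; apply/subsetP => x.
    by rewrite !in_setU !in_setC in_setU negb_or => ->; case: (x \in Bad).
  have := leq_mul (leqnn M3) XY; have := leq_mul (leqnn M3) cBad; move: h2 nb5.
  clear; lia.
have Mn : k * #|V|.+1 * M3 <= n by rewrite -Ev.
have miss := class_miss F2 j0 crit G3 cG norb Ub tqs tq degN hm1 Mn few.
have le := class_le F2 crit G3 cG norb Ub tq degN hm1 Mn.
have ge := class_ge F2 crit G3 cG norb Ub tq degN hm1 Mn few.
pose W := class F G U q Bad; rewrite -/W in miss le ge.
(* Class members miss at most [m0] vertices of another class; with this, [extension] gives the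
   weaker tolerance [m] for arbitrary vertices. *)
pose m0 := 5 * n %/ M3; pose m := n %/ M5; pose a := (M3 + 2) * n %/ (M3 * k).
have m0m : m0 <= m.
  rewrite leq_divRL // -(leq_pmul2l (_ : 0 < 5)) //.
  apply: leq_trans (_ : m0 * M3 <= _); last exact: leq_divM.
  by rewrite mulnCA leq_mul2l hM3b orbT.
have big i : #|V| * m + 4 * m + #|V| + #|F| + 20 < #|W i|.
  rewrite -Ev -Ef; have mM : 4 * k * (v + 5) * m <= n.
    by apply: leq_trans (leq_mul hM5 (leqnn m)) _; rewrite mulnC leq_divM.
  have h1 := leq_mul (leqnn 4) (ge i); have h2 := leq_mul hM3c (leqnn n).
  have w3 : 3 * n <= 4 * k * #|W i|.
    rewrite -(leq_pmul2l M3_gt0); move: h1 h2; rewrite -/n -/k.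
    by move: #|W i| (n) (k) => w u l; clear; lia.
  have k0 : 0 < 4 * k by [].
  rewrite -(ltn_pmul2l k0); apply: leq_trans w3; move: mM nb9 n_gt0.
  by move: (n) (k) (m) => u l e; clear; lia.
have big0 i : #|V| * m0 + 4 * m0 + #|V| + #|F| + 20 < #|W i|.
  apply: leq_ltn_trans (big i); rewrite !leq_add2r leq_add //.
    by rewrite leq_mul2l m0m orbT.
  by rewrite leq_mul2l m0m orbT.
have typ0 i x : x \in W i -> typical F G W m0 i x.
  move=> xi i' ii'; rewrite leq_divRL // mulnC; exact: miss xi ii'.
have Wa i : #|W i| <= a.
  by rewrite leq_divRL ?muln_gt0 ?M3_gt0 // mulnC le.
have Ma : M3 * k * a <= (M3 + 2) * n by rewrite mulnC leq_divM.
have Xb : M3 * (#|~: \bigcup_i W i| + (#|V| * m0 + #|V|)) <= b * n.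
  have h1 : m0 * M3 <= 5 * n := leq_divM _ _.
  have h2 := leq_mul (leqnn v) h1; rewrite -Ev /b; move: few nb7 h2.
  by rewrite -/n -/X; move: (n) (m0) #|X| => u e x; clear; lia.
have ext x := extension F2 j0 crit G3 cG norb deg typ0 big0 Wa x n_gt0 Xb Ma nb8.
have typ i x : x \in W i -> typical F G W m i x.
  by move=> xi i' ii'; apply: leq_trans (typ0 i x xi i' ii') m0m.
(* A vertex of a class keeps its index, so part [i] exceeds [W i] by unclassified vertices only. *)
have ex_typ x : exists i, typical F G W m i x /\ forall i', x \in W i' -> i' = i.
  have [/bigcupP[i _ xi]|no] := boolP (x \in \bigcup_i W i).
    by exists i; split=> [|i' xi']; [apply: typ|apply: class_disjoint Ub tqs _ _ _ xi' xi].
  have [i xi] := ext x; exists i; split=> [i' ii'|i' xi']; last first.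
    by case/bigcupP: no; exists i'.
  have := xi i' ii'; rewrite -/k -Ec2 leq_divRL // => h1.
  rewrite -(leq_pmul2l c2_gt0); apply: leq_trans h1.
  rewrite mulnCA mulnC; apply: leq_mul => //; apply: leq_trans hM3a _.
  by rewrite leq_pmull // muln_gt0 j0.
have /fin_all_exists [P PP] := ex_typ.
exists W, m, P; split=> // [x|i]; first by case: (PP x).
have sub : part P i \subset W i :|: X.
  apply/subsetP => x; rewrite inE in_setU in_setC => /eqP Pi.
  have [/bigcupP[i' _ xi']|] := boolP (x \in classified F G U q Bad); last by rewrite orbT.
  by have [_ /(_ i' xi')] := PP x; rewrite Pi => <-; rewrite xi'.
have h1 := leq_trans (subset_leq_card sub) (leq_card_setU _ _).
have h2 := leq_mul (leqnn (2 * M3)) h1.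
have k3 : 3 <= k by [].
have h3 := leq_trans (leq_mul (leqnn 16) k3) hM3c.
have h4 := leq_trans (leq_mul (leq_mul (leqnn M3) k3) (leqnn #|W i|)) (le i).
rewrite -(leq_pmul2l M3_gt0) -/n; move: h2 h3 h4 few; rewrite -/n.
move: #|W i| #|X| #|part P i| (n) => w x p u h2 h3 h4 few.
have := leq_mul h3 (leqnn u); move: h2 h4 few; clear; lia.
Qed.

(** * Colorings with many colors *)

Lemma num_colors_le (S T : finType) (A : {set {set S}}) (B : {set {set T}}) c c' :
  (forall e, e \in A -> exists2 e', e' \in B & c' e' = c e) ->
  num_colors A c <= num_colors B c'.
Proof.
move=> H; apply: uniq_leq_size; first exact: undup_uniq.
move=> v; rewrite !mem_undup => /mapP[e]; rewrite mem_enum => /H[e' e'B <-] ->.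
by apply: map_f; rewrite mem_enum.
Qed.

Lemma num_colors_injE (T : finType) (A : {set {set T}}) c : {in A &, injective c} ->
  num_colors A c = #|A|.
Proof.
move=> injc; rewrite /num_colors undup_id ?size_map -?cardE // map_inj_in_uniq ?enum_uniq //.
by move=> e e'; rewrite !mem_enum; apply: injc.
Qed.

Lemma num_colors_card (T : finType) (A : {set {set T}}) c : num_colors A c <= #|A|.
Proof. by rewrite /num_colors cardE -(size_map c) size_undup. Qed.

Lemma color_representatives (T : finType) (A : {set {set T}}) (c : {set T} -> nat) :
  exists G : {set {set T}}, [/\ G \subset A, {in G &, injective c} &
    forall e, e \in A -> exists2 e', e' \in G & c e' = c e].
Proof.
(* The predicate of [pick] is the same for all edges of one color, hence so is the
   representative. *)
pose r e := odflt e [pick e' in A | c e' == c e].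
have rP e : e \in A -> r e \in A /\ c (r e) = c e.
  by rewrite /r; case: pickP => [e' /andP[e'A /eqP ce']|/(_ e) /= + eA]; rewrite ?eA ?eqxx.
exists (r @: A); split.
- by apply/subsetP => _ /imsetP[e eA ->]; case: (rP e eA).
- move=> _ _ /imsetP[e eA ->] /imsetP[e' e'A ->]; have [_ ->] := rP e eA.
  have [_ ->] := rP e' e'A => E; rewrite /r E.
  by case: pickP => [//|/(_ e')]; rewrite e'A eqxx.
by move=> e eA; exists (r e); [apply: imset_f|case: (rP e eA)].
Qed.

(** Match positions in two enumerations of [K], one starting with [A] and one with [J]. *)
Lemma inject_into (K : finType) (A J : {set K}) : #|A| <= #|J| ->
  exists s : K -> K, injective s /\ forall x, x \in A -> s x \in J.
Proof.
move=> AJ; pose s := enum A ++ enum (~: A); pose t := enum J ++ enum (~: J).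
have us (B : {set K}) : uniq (enum B ++ enum (~: B)).
  rewrite cat_uniq !enum_uniq andbT; apply/hasPn => x.
  by rewrite !mem_enum inE.
have zs (B : {set K}) : size (enum B ++ enum (~: B)) = #|K|.
  by rewrite size_cat -!cardE cardsC.
have ms x : x \in s by rewrite mem_cat !mem_enum inE orbN.
have is_ x : index x s < #|K| by rewrite -(zs A) index_mem ms.
exists (fun x => nth x t (index x s)); split=> [x y|x xA].
  rewrite (set_nth_default y) ?zs // => /eqP; rewrite nth_uniq ?zs //; last exact: us.
  by move/eqP; apply: (@index_inj _ x s); rewrite ms.
have xi : index x s < #|J|.
  apply: leq_trans AJ; rewrite cardE /s index_cat mem_enum xA.
  by rewrite index_mem mem_enum.
rewrite nth_cat -cardE xi -mem_enum mem_nth // -cardE //.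
Qed.

Lemma link_degree (T : finType) (G : {set {set T}}) x : G \subset triples T ->
  2 * #|[set e in G | x \in e]| <= \sum_y #|link G x y|.
Proof.
move=> G3; set Gx := [set e in _ | _].
have -> : \sum_y #|link G x y| = \sum_(t : T * T | t.2 \in link G x t.1) 1.
  rewrite [RHS]big_mkcond -(pair_big_dep xpredT (fun _ => xpredT)
    (fun y z => if z \in link G x y then 1 else 0)) /=.
  by apply: eq_bigr => y _; rewrite -sum1_card big_mkcond.
pose f (t : T * T) := t.2 |: [set x; t.1].
rewrite (partition_big f (mem Gx)) /= => [|t]; last by rewrite !inE eqxx orbT => ->.
rewrite mulnC -sum_nat_const; apply: leq_sum => e; rewrite inE => /andP[eG xe].
have e3 : #|e :\ x| = 2.
  by have := subsetP G3 e eG; rewrite inE (cardsD1 x) xe => /eqP[].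
have /cards2P[y [z [yz E]]] : #|e :\ x| == 2 by rewrite e3.
have eE : e = z |: [set x; y].
  by rewrite -(setD1K xe) E; apply/setP => v; rewrite !inE;
    case: (v == x); case: (v == y); case: (v == z).
have eE' : e = y |: [set x; z].
  by rewrite eE; apply/setP => v; rewrite !inE; case: (v == x); case: (v == y); case: (v == z).
rewrite sum1dep_card; apply: leq_trans (_ : #|[set (y, z); (z, y)]| <= _).
  by rewrite cards2 xpair_eqE negb_and yz.
apply: subset_leq_card; apply/subsetP => t; rewrite !inE => /orP[]/eqP-> /=.
  by rewrite /f /= -eE eG eqxx.
by rewrite /f /= -eE' eG eqxx.
Qed.

Section ManyColors.
Variables (j l : nat) (V : finType) (F : {set {set V}}).
Hypothesis F2 : uniform 2 F.
Hypothesis j0 : 0 < j.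
Hypothesis crit : doubly_edge_critical j.+3 F.
Hypothesis cls : in_class j.+3 l F.

(** Each extra triple has two vertices in some part, and by [same_part_same_color] distinct ones use
    distinct parts. So there are at most [k], which settles [l = p]; for [l < p] the partition
    defining the class of [F] has [l] inner edges in distinct parts, which fit on the parts of the
    extra colors. *)
Lemma too_many_extra_colors (T : finType) (c : {set T} -> nat) (G : {set {set T}})
    (W : 'I_j.+2 -> {set T}) m (P : T -> 'I_j.+2) (E : {set {set T}}) :
  G \subset triples T -> {in G &, injective c} ->
  ~ has_rainbow (triples T) c (expansion 3 F) ->
  (forall i x, x \in W i -> typical F G W m i x) ->
  (forall i, #|V| * m + 4 * m + #|V| + #|F| + 20 < #|W i|) ->
  (forall x, typical F G W m (P x) x) ->
  E \subset G -> (forall e, e \in E -> e \notin crossing P) -> l <= #|E| -> False.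
Proof.
move=> G3 cG norb Wtyp Wbig Ptyp EG Enc lE.
have AA := same_part_same_color F2 crit G3 cG norb Wtyp Wbig.
have Eind e : exists i, e \in E -> exists y z u, [/\ uniq [:: y; z; u], e = [set y; z; u],
    P y = i & P z = i].
  have [eE|_] := boolP (e \in E); last by exists ord0.
  have /card3P [x [y [z [us eE3]]]] : #|e| = 3.
    by have := subsetP G3 e (subsetP EG e eE); rewrite inE => /eqP.
  have := Enc e eE; rewrite eE3 crossing3 // !negb_and !negbK.
  have us' : uniq [:: x; z; y] /\ uniq [:: y; z; x].
    move: us; rewrite /= !inE !negb_or !andbT => /andP[/andP[xy xz] yz].
    by rewrite ![z == _]eq_sym ![y == x]eq_sym xy xz yz.
  case/or3P => /eqP Exy; [exists (P x) => _; exists x, y, z|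
     exists (P x) => _; exists x, z, y|exists (P y) => _; exists y, z, x].
  - by split.
  - by split=> //; [case: us'|rewrite -!setUA (setUC [set y])].
  by split=> //; [case: us'|rewrite setUC setUA setUC setUA].
have /fin_all_exists [f fP] := Eind.
have finj : {in E &, injective f}.
  move=> e e' eE e'E ff; have [y [z [u [us Ee Py Pz]]]] := fP e eE.
  have [y' [z' [u' [us' Ee' Py' Pz']]]] := fP e' e'E.
  apply: cG; [exact: subsetP eE|exact: subsetP e'E|].
  rewrite Ee Ee'; apply: (AA (f e)) => //; [rewrite -Py|rewrite -Pz|rewrite ff -Py'|rewrite ff -Pz'];
    exact: Ptyp.
case: cls => [[/andP[l1 lk] [P0 P0u P0l] _]|[El _]]; last first.
  have := max_card (mem (f @: E)); rewrite card_in_imset // card_ord; lia.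
pose J := f @: E; have cJ : l <= #|J| by rewrite card_in_imset.
pose A i := [set e in F | e \subset [set x | P0 x == i]].
have A1 i : #|A i| <= 1.
  move: P0u; rewrite inE => /eqP <-.
  by have := leq_bigmax (F := index_vector F P0) i; rewrite ffunE.
pose B := \bigcup_i A i.
have cB : #|B| <= l.
  by rewrite -P0l; apply: leq_trans (card_bigcup_le _ _) _; apply: leq_sum => i _; rewrite ffunE.
pose pt (e : {set V}) : 'I_j.+2 := odflt ord0 [pick i | e \subset [set x | P0 x == i]].
have ptP : {in B, forall e : {set V}, forall v, v \in e -> P0 v = pt e}.
  move=> e /bigcupP[i _]; rewrite inE => /andP[_ ei] v ve; rewrite /pt.
  case: pickP => [i' /subsetP /(_ v ve)|/(_ i)]; first by rewrite inE => /eqP.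
  by rewrite ei.
have BF : B \subset F by apply/bigcupsP => i _; apply/subsetP => e; rewrite inE => /andP[].
have BA e : e \in B -> e \in A (pt e).
  move=> eB; rewrite inE (subsetP BF e eB); apply/subsetP => v ve.
  by rewrite inE (ptP e eB v ve).
have ptinj : {in B &, injective pt}.
  move=> e e' /BA eA /BA e'A ee; apply: (card_le1_eqP (A1 (pt e))) => //.
  by rewrite ee.
(* The parts of [F] with an inner edge are moved to parts that carry an extra color. *)
have [s [si sJ]] : exists s : 'I_j.+2 -> 'I_j.+2, injective s /\ forall x, x \in pt @: B -> s x \in J.
  by apply: inject_into; apply: leq_trans (leq_imset_card _ _) (leq_trans cB cJ).
pose gamma i := if [pick e in E | f e == i] is Some e then c e else 0.
have gammaE e : e \in E -> gamma (f e) = c e.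
  move=> eE; rewrite /gamma; case: pickP => [e' /andP[e'E /eqP fe]|/(_ e)]; last by rewrite eE eqxx.
  by rewrite (finj e' e).
apply: (no_class_partition F2 crit G3 cG norb Wtyp Wbig (P := P0) (s := s) (B := B)
  (part := pt) (gamma := gamma) (J := J) si BF) => //.
- move=> v w vw /setDP[vwF vwB]; apply: contra vwB => /eqP Pvw.
  apply/bigcupP; exists (P0 v) => //; rewrite inE vwF; apply/subsetP => x.
  by rewrite !inE => /orP[]/eqP->; rewrite // Pvw.
- by move=> e eB; apply/sJ/imset_f.
- move=> _ _ /imsetP[e eE ->] /imsetP[e' e'E ->]; rewrite !gammaE // => ee.
  by rewrite (cG e e') // (subsetP EG).
move=> _ /imsetP[e eE ->] x y z xW yW us; rewrite gammaE //.
have [y' [z' [u' [us' Ee' Py' Pz']]]] := fP e eE.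
rewrite Ee'; apply: (AA (f e)) => //; [exact: Wtyp|exact: Wtyp| |].
  by rewrite -Py'; apply: Ptyp.
by rewrite -Pz'; apply: Ptyp.
Qed.

(** The last hypothesis bounds the number of colors private to each vertex, hence the links of the
    representatives [G]. At most a Turan number of representatives share their color with a crossing
    triple, so at least [l] do not. *)
Lemma rainbow_of_many_colors : exists n1, forall (T : finType) (c : {set T} -> nat),
  n1 <= #|T| -> turan_number j.+3 #|T| 3 + l <= num_colors (triples T) c ->
  (forall x, num_colors [set e in triples T | x \notin e] c + turan_number j.+3 #|T| 3 <=
    num_colors (triples T) c + turan_number j.+3 #|T|.-1 3) ->
  has_rainbow (triples T) c (expansion 3 F).
Proof.
have [n1 n1P] := vertex_partition F2 j0 crit; exists (n1 + 3) => T c nT many deg.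
apply: contrapT => norb.
have [G [GT cG Grep]] := color_representatives (triples T) c.
have cardG : #|G| = num_colors (triples T) c.
  apply/eqP; rewrite eqn_leq -(num_colors_injE cG).
  rewrite !num_colors_le // => e eG; exists e => //; exact: subsetP GT e eG.
have [|x|W [m [P [Wtyp Wbig Ptyp half]]]] := n1P T c G _ GT cG norb.
- by apply: leq_trans nT; rewrite leq_addr.
- have Gx : #|G| <= #|[set e in G | x \in e]| + num_colors [set e in triples T | x \notin e] c.
    rewrite -(cardsID [set e : {set T} | x \in e] G); apply: leq_add.
      by apply: subset_leq_card; apply/subsetP => e; rewrite !inE.
    rewrite -(num_colors_injE (A := G :\: _) (c := c)); last first.
      by move=> e e' /setDP[eG _] /setDP[e'G _]; apply: cG.
    apply: num_colors_le => e; rewrite 2!inE => /andP[xe eG].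
    by exists e; rewrite // inE (subsetP GT).
  have := turan_step_lower j #|T|.-1; rewrite prednK; last by apply: leq_trans nT; rewrite addn3.
  have h1 := leq_mul (leqnn (j.+2 ^ 2)) (link_degree x GT).
  have h2 : j.+2 ^ 2 * (2 * turan_number j.+3 #|T| 3) <=
      j.+2 ^ 2 * (2 * #|[set e in G | x \in e]|) + j.+2 ^ 2 * (2 * turan_number j.+3 #|T|.-1 3).
    rewrite -mulnDr -mulnDr !leq_pmul2l ?expn_gt0 //.
    move: Gx (deg x); rewrite -cardG; clear; lia.
  move: h1 h2; clear; lia.
pose E := [set e in G | c e \notin [seq c e' | e' in crossing P]].
have EG : E \subset G by apply/subsetP => e; rewrite inE => /andP[].
apply: (too_many_extra_colors GT cG norb Wtyp Wbig Ptyp EG).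
  by move=> e; rewrite inE => /andP[_]; apply: contra => eP; apply: map_f; rewrite mem_enum.
have GE : #|G :\: E| <= #|crossing P|.
  rewrite -(num_colors_injE (A := G :\: _) (c := c)); last first.
    by move=> e e' /setDP[eG _] /setDP[e'G _]; apply: cG.
  apply: leq_trans (num_colors_card (crossing P) c); apply: num_colors_le => e.
  case/setDP=> eG; rewrite inE eG negbK => /mapP[e'].
  by rewrite mem_enum => e'P ->; exists e'.
have T2 : 2 < #|T| by apply: leq_trans nT; rewrite addn3.
have := crossing_le_turan (P := P) j0 T2 half.
have := cardsID E G; rewrite (setIidPr EG) cardG; move: many GE; clear; lia.
Qed.

End ManyColors.

(** * Upper and lower bounds *)

Lemma has_rainbow_induced (T : finType) (S : {set T}) (W : finType) (H : {set {set W}})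
    (c : {set T} -> nat) :
  has_rainbow (triples {x | x \in S}) (fun e => c (val @: e)) H ->
  has_rainbow (triples T) c H.
Proof.
case=> g [gi gS gc]; exists (val \o g); split.
- exact: inj_comp val_inj gi.
- apply/subsetP => _ /imsetP[e eH ->]; rewrite imset_comp inE card_imset; last exact: val_inj.
  by have := subsetP gS _ (imset_f _ eH); rewrite inE.
move=> _ _ /imsetP[e eH ->] /imsetP[e' e'H ->]; rewrite (imset_comp val g e) (imset_comp val g e') => E.
by rewrite (gc _ _ (imset_f _ eH) (imset_f _ e'H) E).
Qed.

Section Bounds.
Variables (j l : nat) (V : finType) (F : {set {set V}}).
Hypothesis F2 : uniform 2 F.
Hypothesis j0 : 0 < j.
Hypothesis crit : doubly_edge_critical j.+3 F.
Hypothesis cls : in_class j.+3 l F.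

Definition colors_in (T : finType) (c : {set T} -> nat) (S : {set T}) : nat :=
  num_colors [set e in triples T | e \subset S] c.

(* Deleting a vertex that lies in few private colors increases the excess over the
   Turan number, which is bounded; a smallest set of excess at least [#|T| - #|S|]
   has therefore no such vertex, and it is large. *)
Lemma forces_rainbow_turan : exists n0, forall n, n0 <= n ->
  forces_rainbow n 3 (expansion 3 F) (turan_number j.+3 n 3 + l).
Proof.
have [n1 n1P] := rainbow_of_many_colors F2 j0 crit cls.
exists (n1 + 2 ^ n1 + 1) => n nbig c; rewrite -/(triples 'I_n) => many.
pose good (S : {set 'I_n}) := turan_number j.+3 #|S| 3 + l + (n - #|S|) <= colors_in c S.
have goodT : good setT.
  rewrite /good cardsT card_ord subnn addn0 /colors_in.
  apply: leq_trans many _; apply: num_colors_le => e eT; exists e => //.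
  by rewrite inE eT subsetT.
case: (@arg_minnP _ [set: 'I_n] good (fun S : {set 'I_n} => #|S|) goodT) => S gS Smin.
have cS : colors_in c S <= 2 ^ #|S|.
  apply: leq_trans (num_colors_card _ _) _; rewrite -card_powerset.
  by apply: subset_leq_card; apply/subsetP => e; rewrite powersetE inE => /andP[].
(* Otherwise the surplus [n - #|S|] would exceed the number of subsets of [S]. *)
have Sbig : n1 <= #|S|.
  rewrite leqNgt; apply/negP => lt.
  have : 2 ^ #|S| <= 2 ^ n1 by rewrite leq_exp2l // ltnW.
  move: gS cS nbig lt; rewrite /good; move: (2 ^ n1) (2 ^ #|S|) => a b; lia.
pose T : finType := {x | x \in S}.
have cT : #|T| = #|S| by rewrite card_sig.
pose c' (e : {set T}) := c (val @: e).
have eqc (D : {set 'I_n}) : D \subset S ->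
    num_colors [set e in triples T | val @: e \subset D] c' = colors_in c D.
  move=> DS; apply/eqP; rewrite eqn_leq; apply/andP; split; apply: num_colors_le => e.
    rewrite !inE => /andP[e3 eD]; exists (val @: e) => //.
    by rewrite !inE card_imset ?e3 //; apply: val_inj.
  rewrite !inE => /andP[e3 eD]; pose e' : {set T} := [set x | val x \in e].
  have E : val @: e' = e.
    apply/setP => x; apply/imsetP/idP => [[y + ->]|xe]; first by rewrite inE.
    have xS : x \in S := subsetP DS _ (subsetP eD _ xe).
    by exists (Sub x xS); rewrite ?inE SubK.
  exists e'; last by rewrite /c' E.
  by rewrite !inE E eD andbT -(card_imset _ val_inj) E.
have valS (e : {set T}) : val @: e \subset S.
  by apply/subsetP => _ /imsetP[x _ ->]; apply: valP.
have allT : num_colors (triples T) c' = colors_in c S.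
  rewrite -(eqc S (subxx S)); congr (num_colors _ _).
  by apply/setP => e; rewrite [in RHS]inE valS andbT.
apply: (@has_rainbow_induced _ S); apply: n1P; rewrite cT // -/c' allT.
  exact: leq_trans (leq_addr _ _) gS.
move=> x; have xS : val x \in S := valP x.
have cSx : #|S| = #|S :\ val x|.+1 by rewrite (cardsD1 (val x)) xS.
(* By minimality, deleting a vertex loses at least the Turan increment in colors. *)
have : ~~ good (S :\ val x).
  by apply/negP => /Smin; rewrite cSx ltnn.
rewrite /good -ltnNge -(eqc _ (subD1set _ _)) => h1.
have h2 : num_colors [set e in triples T | x \notin e] c' <=
    num_colors [set e in triples T | val @: e \subset S :\ val x] c'.
  apply: num_colors_le => e; rewrite 2!inE => /andP[e3 xe]; exists e => //.
  rewrite !inE e3 /= subsetD1 valS /=; apply: contra xe => /imsetP[y ye /val_inj ->] //.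
have := subset_leq_card (subsetT S); rewrite cardsT card_ord.
move=> cSn; apply: leq_trans (leq_add h2 (leqnn _)) _.
by move: gS h1 cSn; rewrite /good cSx /=; clear; lia.
Qed.

(** * The extremal coloring *)

Section LowerBound.
Hypothesis l2 : 1 < l <= j.+3.
Variable n : nat.
Hypothesis n_big : 3 * j.+2 <= n.

Local Notation R i := (residue_part n j.+2 i).

Definition crowded (e : {set 'I_n}) : 'I_j.+2 := odflt ord0 [pick i : 'I_j.+2 | 1 < #|e :&: R i|].

(** Turan triples get distinct values from [l] on, the others the [l - 1] values up to [l - 2]; the
    minimum merges the parts from [l - 2] on. *)
Definition extremal_coloring (e : {set 'I_n}) : nat :=
  if e \in turan j.+3 n 3 then l + enum_rank e else minn (crowded e) l.-2.

Lemma crowdedE (e : {set 'I_n}) (i : 'I_j.+2) : #|e| = 3 -> 1 < #|e :&: R i| -> crowded e = i.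
Proof.
move=> e3 ei; rewrite /crowded; case: pickP => [i' ei'|/(_ i)]; last by rewrite ei.
apply/eqP; apply: contraT => ii'; have : [disjoint e :&: R i & e :&: R i'].
  rewrite -setI_eq0; apply/eqP/setP => x; rewrite !inE; apply/negP.
  move=> /andP[/andP[_ /eqP xi] /andP[_ /eqP xi']]; case/eqP: ii'; apply: val_inj.
  by rewrite /= -xi -xi'.
rewrite -(leq_card_setU _ _) => /eqP E.
have : #|e :&: R i :|: e :&: R i'| <= #|e| by rewrite -setIUr subset_leq_card ?subsetIl.
rewrite E e3; move: ei ei'; clear; lia.
Qed.

(** A color [v < l - 1] occurs on the triple [v], [v + k], [v + 2 k] inside one residue class, which
    fits because [n] is at least [3 k]. *)
Lemma num_colors_extremal :
  turan_number j.+3 n 3 + l.-1 <= num_colors (complete_rgraph n 3) extremal_coloring.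
Proof.
pose s := [seq l + enum_rank e | e in turan j.+3 n 3] ++ iota 0 l.-1.
have -> : turan_number j.+3 n 3 + l.-1 = size s by rewrite size_cat size_map size_iota -cardE.
apply: uniq_leq_size.
  rewrite cat_uniq iota_uniq andbT map_inj_in_uniq ?enum_uniq /=; last first.
    by move=> e e' _ _ /addnI/val_inj/enum_rank_inj.
  apply/hasPn => i; rewrite mem_iota add0n => /andP[_ il]; apply/mapP => -[e _ E].
  by move: il; rewrite E; case/andP: l2; clear; lia.
move=> v; rewrite mem_undup mem_cat => /orP[/mapP[e]|].
  rewrite mem_enum => eT ->; apply/mapP; exists e; last by rewrite /extremal_coloring eT.
  by move: eT; rewrite mem_enum inE => /andP[].
rewrite mem_iota add0n => /andP[_ vl].
have vj : v < j.+2 by case/andP: l2; move: vl; clear; lia.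
have lt t : t < 3 -> v + t * j.+2 < n by move: n_big vj; clear; nia.
pose x (t : 'I_3) : 'I_n := Ordinal (lt t (ltn_ord t)).
have xi : injective x.
  move=> t t' /(congr1 val) /= /addnI/eqP; rewrite eqn_mul2r /= => /eqP; exact: val_inj.
pose e := [set x t | t : 'I_3].
have e3 : #|e| = 3 by rewrite card_imset // card_ord.
have eR : e \subset R v.
  by apply/subsetP => _ /imsetP[t _ ->]; rewrite inE /= addnC modnMDl modn_small.
have eI : #|e :&: R (Ordinal vj)| = 3 by rewrite (setIidPl eR) e3.
apply/mapP; exists e; first by rewrite mem_enum inE e3.
rewrite /extremal_coloring ifF; last first.
  apply/negP; rewrite inE => /andP[_ /forallP /(_ (Ordinal vj))].
  by rewrite [_.-1]/= eI.
rewrite (@crowdedE e (Ordinal vj)) ?eI // /=; move: vl; clear; lia.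
Qed.

(** A rainbow copy partitions [V] by residues. Edges of [F] inside parts get colors below [l - 1],
    so there is at most one in each part and fewer than [l] in all, contrary to the class of [F]. *)
Lemma extremal_no_rainbow :
  ~ has_rainbow (complete_rgraph n 3) extremal_coloring (expansion 3 F).
Proof.
case=> g [gi gS gc]; have k0 : 0 < j.+2 by [].
pose P := [ffun v => residue k0 (g (inl v))].
pose A i := [set e in F | e \subset [set x | P x == i]].
pose img (e : {e | e \in F}) := g @: expansion_edge 3 e.
have imgS e : img e \in [set g @: (e : {set expansion_vertex 3 F}) | e in expansion 3 F].
  by apply/imset_f/imset_f.
have bad (e : {e | e \in F}) i : val e \in A i -> extremal_coloring (img e) = minn i l.-2.
  rewrite inE => /andP[eF ei].
  have e3 : #|img e| = 3 by have := subsetP gS _ (imgS e); rewrite inE => /eqP.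
  have two : 1 < #|img e :&: R i|.
    have /eqP e2 := forall_inP F2 _ eF.
    rewrite -[X in _ < X]/(#|_|) -e2.
    rewrite -(card_imset (mem (val e)) (_ : injective (fun v => g (inl v)))); last first.
      by move=> v w /gi [].
    apply: subset_leq_card; apply/subsetP => _ /imsetP[v ve ->]; rewrite in_setI.
    rewrite imset_f /=; last by apply/setUP; left; apply: imset_f.
    by have := subsetP ei v ve; rewrite !inE /P ffunE => /eqP <-.
  rewrite /extremal_coloring ifF ?(crowdedE e3 two) //.
  apply/negP; rewrite inE => /andP[_ /forallP /(_ i)].
  by rewrite leqNgt two.
have inj (e e' : {set V}) i i' : e \in A i -> e' \in A i' ->
    minn i l.-2 = minn i' l.-2 -> e = e'.
  move=> eA e'A E; have := eA; have := e'A; rewrite !inE => /andP[e'F _] /andP[eF _].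
  have := gc _ _ (imgS (exist _ e eF)) (imgS (exist _ e' e'F)).
  rewrite (bad (exist _ e eF) i) // (bad (exist _ e' e'F) i') // => /(_ E) /(imset_inj gi) Ee.
  have : (inr (exist _ e eF, ord0) : expansion_vertex 3 F) \in expansion_edge 3 (exist _ e' e'F).
    by rewrite -Ee; apply/setUP; right; apply: imset_f.
  by case/setUP => /imsetP[] // i0 _ [].
have A1 i : #|A i| <= 1.
  by apply/card_le1_eqP => e e' eA e'A; apply: inj e'A eA _.
have [e1 e1F] : exists e, e \in F.
  by have [_ [a [a' [b [b' [[_ _ aF _ _] _]]]]]] := critical_partition F2 crit; exists [set a; a'].
have PU : P \in unit_partitions j.+3 F.
  rewrite inE eqn_leq; apply/andP; split.
    by apply/bigmax_leqP => i _; rewrite ffunE; apply: A1.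
  (* Without inner edges, [P] would be a proper coloring with [k] colors. *)
  rewrite lt0n; apply/eqP => z.
  have /negP := not_colorable_del crit e1F; apply; apply/existsP; exists P.
  apply/proper_coloringP => x y xy /setD1P[_ xyF]; apply/eqP => Pxy.
  have : 0 < index_vector F P (P x).
    rewrite ffunE card_gt0; apply/set0Pn; exists [set x; y].
    by rewrite inE xyF; apply/subsetP => v; rewrite !inE => /orP[]/eqP->; rewrite ?Pxy.
  by have := leq_bigmax (F := index_vector F P) (P x); rewrite -/(norm_inf _) z leqn0 => /eqP->.
case: cls => [[_ _ /(_ P PU)]|[_ U0]]; last by rewrite U0 inE in PU.
apply/negP; rewrite -ltnNge; case/andP: l2 => l1 _.
pose I := [set i | A i != set0].
have normI : norm_one (index_vector F P) <= #|I|.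
  apply: leq_trans (_ : \sum_i (i \in I : nat) <= _).
    apply: leq_sum => i _; rewrite ffunE inE -card_gt0; have := A1 i; rewrite -/(A i).
    by case: #|A i| => [|[]].
  by rewrite -sum1_card [X in _ <= X]big_mkcond /=; apply: leq_sum => i _; case: (i \in I).
apply: leq_ltn_trans normI _; suff : #|I| <= l.-2.+1 by move: l1; clear; lia.
pose f (i : 'I_j.+2) : 'I_l.-2.+1 := inord (minn i l.-2).
rewrite -(card_ord l.-2.+1); apply: (@leq_card_in _ _ f) => i i'.
rewrite !inE => /set0Pn[e eA] /set0Pn[e' e'A] /(congr1 val).
rewrite /= !inordK ?ltnS ?geq_minr // => E.
move: (e'A); rewrite -(inj e e' i i' eA e'A E) !inE => /andP[eF /subsetP ei'].
move: (eA); rewrite inE => /andP[_ /subsetP ei].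
have [v [w [_ Ee]]] := uniform2P F2 eF; have ve : v \in e by rewrite Ee set21.
by have := ei v ve; have := ei' v ve; rewrite !inE => /eqP-> /eqP.
Qed.

End LowerBound.

End Bounds.

Theorem theorem1p2 (p l : nat) (V : finType) (F : {set {set V}}) :
  3 < p -> 2 <= l <= p ->
  uniform 2 F -> doubly_edge_critical p F -> in_class p l F ->
  exists n0 : nat, forall n : nat, n0 <= n ->
    ar n 3 (expansion 3 F) = turan_number p n 3 + l.
Proof.
(* With [p = j + 3], the number of parts is [k = j + 2] and [3 < p] becomes [0 < j]. *)
case: p => [|[|[|j]]] // j0 l2 F2 crit cls.
have [n0 n0P] := forces_rainbow_turan F2 j0 crit cls.
exists (n0 + 3 * j.+2) => n nbig; rewrite /ar.
case: ex_minnP => m /asboolP forces_m min_m; apply/eqP; rewrite eqn_leq.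
rewrite min_m; last by apply/asboolP/n0P; apply: leq_trans nbig; rewrite leq_addr.
have nj : 3 * j.+2 <= n by apply: leq_trans nbig; rewrite leq_addl.
rewrite leqNgt; apply/negP => lt; apply: (extremal_no_rainbow F2 crit cls l2 (n := n)).
apply: forces_m; apply: leq_trans (num_colors_extremal l2 nj).
by case/andP: l2; move: lt; clear; lia.
Qed.
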